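(* (i) For every integer $n$ with $6\le n\le 8$, $sat(n,K_{3,3})=2n$. (ii) For every integer $n\ge 9$, $sat_2(n,K_{3,3})=3n-9$ and $sat_5(n,K_{3,3})\ge 3n-9$.
   Context: All graphs are finite and simple. $K_{3,3}$ is the complete bipartite graph with both parts of size $3$, and $\overline{G}$ is the complement of $G$. A graph $G$ is $F$-saturated if $G$ does not contain $F$ as a (not necessarily induced) subgraph, but for every edge $e\in E(\overline{G})$ the graph $G+e$ contains $F$ as a subgraph. The saturation number $sat(n,F)$ is the minimum number of edges in an $n$-vertex $F$-saturated graph. For an integer $\delta$, $sat_\delta(n,F)$ is the minimum number of edges in an $F$-saturated graph with $n$ vertices and minimum degree exactly $\delta$. The inequality $sat_5(n,K_{3,3})\ge 3n-9$ means that every $K_{3,3}$-saturated graph with $n$ vertices and minimum degree $5$ has at least $3n-9$ edges (so it holds vacuously if there is no such graph). *)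

(* Defs.v *)
From mathcomp Require Import all_boot.

Set Implicit Arguments.
Unset Strict Implicit.
Unset Printing Implicit Defensive.

Record sgraph (V : finType) := SGraph {
  adj : rel V;
  adj_sym : symmetric adj;
  adj_irr : irreflexive adj }.

Definition edges (V : finType) (G : sgraph V) : {set {set V}} :=
  [set [set x; y] | x in V, y in adj G x].

Definition degree (V : finType) (G : sgraph V) (v : V) : nat :=
  #|[set w | adj G v w]|.

Section Complement.
Variables (V : finType) (G : sgraph V).

Definition compl_rel : rel V := fun x y => (x != y) && ~~ adj G x y.

Lemma compl_rel_sym : symmetric compl_rel.
Proof. by move=> x y; rewrite /compl_rel eq_sym (adj_sym G). Qed.

Lemma compl_rel_irr : irreflexive compl_rel.
Proof. by move=> x; rewrite /compl_rel eqxx. Qed.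

Definition compl : sgraph V := SGraph compl_rel_sym compl_rel_irr.

End Complement.

Section AddEdge.
Variables (V : finType) (G : sgraph V) (e : {set V}).

(* Only meaningful when e is a two-element set; otherwise G is unchanged. *)
Definition add_edge_rel : rel V :=
  fun x y => adj G x y || ((x != y) && (e == [set x; y])).

Lemma add_edge_rel_sym : symmetric add_edge_rel.
Proof.
by move=> x y; rewrite /add_edge_rel (adj_sym G) [y == x]eq_sym [[set y; x]]setUC.
Qed.

Lemma add_edge_rel_irr : irreflexive add_edge_rel.
Proof. by move=> x; rewrite /add_edge_rel (adj_irr G) eqxx. Qed.

Definition add_edge : sgraph V := SGraph add_edge_rel_sym add_edge_rel_irr.

End AddEdge.

Section CompleteBipartite.
Variables (p q : nat).

Definition Kbip_rel : rel ('I_p + 'I_q)%type :=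
  fun x y => match x, y with
             | inl _, inr _ | inr _, inl _ => true
             | _, _ => false
             end.

Lemma Kbip_rel_sym : symmetric Kbip_rel.
Proof. by move=> [x|x] [y|y]. Qed.

Lemma Kbip_rel_irr : irreflexive Kbip_rel.
Proof. by move=> [x|x]. Qed.

Definition Kbip : sgraph ('I_p + 'I_q)%type := SGraph Kbip_rel_sym Kbip_rel_irr.

End CompleteBipartite.

(* Subgraph containment up to isomorphism, not necessarily induced. *)
Definition contains (U V : finType) (F : sgraph U) (G : sgraph V) : Prop :=
  exists f : U -> V, injective f /\ forall x y, adj F x y -> adj G (f x) (f y).

Definition saturated (U V : finType) (F : sgraph U) (G : sgraph V) : Prop :=
  ~ contains F G /\
  forall e : {set V}, e \in edges (compl G) -> contains F (add_edge G e).

Definition is_lower_bound (P : nat -> Prop) (m : nat) : Prop :=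
  forall k, P k -> m <= k.

Definition is_minimum (P : nat -> Prop) (m : nat) : Prop :=
  P m /\ is_lower_bound P m.

Definition min_degree_is (V : finType) (G : sgraph V) (d : nat) : Prop :=
  is_minimum (fun k => exists v, degree G v = k) d.

(* The edge counts realised by n-vertex F-saturated graphs; every n-vertex
   graph is isomorphic to one on 'I_n. *)
Definition sat_sizes (n : nat) (U : finType) (F : sgraph U) (k : nat) : Prop :=
  exists G : sgraph 'I_n, saturated F G /\ #|edges G| = k.

Definition sat_sizes_deg (d n : nat) (U : finType) (F : sgraph U) (k : nat) :
    Prop :=
  exists G : sgraph 'I_n,
    [/\ saturated F G, min_degree_is G d & #|edges G| = k].

(* Saturation numbers are relations, as the minimum need not exist when a
   minimum degree is prescribed: sat_is n F m reads sat(n,F) = m, sat_deg_is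
   d n F m reads sat_d(n,F) = m (so that the minimum is attained), and
   sat_deg_ge d n F m reads sat_d(n,F) >= m (vacuous if there is no graph). *)
Definition sat_is (n : nat) (U : finType) (F : sgraph U) (m : nat) : Prop :=
  is_minimum (sat_sizes n F) m.

Definition sat_deg_is (d n : nat) (U : finType) (F : sgraph U) (m : nat) :
    Prop :=
  is_minimum (sat_sizes_deg d n F) m.

Definition sat_deg_ge (d n : nat) (U : finType) (F : sgraph U) (m : nat) :
    Prop :=
  is_lower_bound (sat_sizes_deg d n F) m.

(* Main.v *)
Require Import Defs.
From mathcomp Require Import all_boot.
From mathcomp Require Import zify.

(* If uv is a non-edge of a K_{3,3}-saturated graph, then some pair of neighbours
   of u and some pair of neighbours of v span a complete K_{2,2} (u and v are
   "linked"); every estimate comes from applying this to well-chosen non-edges.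

   Degree 2. If N(v) = {x, y}, every vertex outside {v, x, y} has exactly two
   neighbours in the core C = (N(x) :&: N(y)) - v, which fixes the number of
   edges up to those inside the rest D and between D and {x, y}. The bound
   3n - 9 fails only if D has three tree components not joined to {x, y}.
   Linking leaves of these trees orients each pair of trees; at most one arrow
   leaves each leaf, so the arrows form a 3-cycle, which forces a subset of one
   of the trees to have minimum degree 2.

   Degrees 3 and 5. Let N = N(v), let W be the set of non-neighbours of v and
   A the set of vertices of W with at least two neighbours in N. A vertex of W
   has two neighbours in A with a common pair of neighbours in N, or one in A
   and one in N, or two in N; in the last case N contains a 4-cycle. Charge is
   moved along the edges between A and W, and the few tight configurations are
   killed by linking a vertex of W to a non-neighbour in N. In degree 5 the
   discharging fails at "bad" vertices, but such a vertex has degree 5 and a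
   neighbourhood without 4-cycles, so it can replace v.

   The extremal graphs are octahedra with a K_1 or K_2 joined to each antipodal
   pair of vertices, plus disjoint triangles joined to one of these pairs. *)

Set Implicit Arguments.
Unset Strict Implicit.
Unset Printing Implicit Defensive.

(** * Degrees into a vertex set and edge counts *)

Section Degrees.
Variables (V : finType) (G : sgraph V).
Implicit Types (A B S : {set V}) (x y z u w : V).

Definition degin A x : nat := \sum_(y in A) adj G x y.

Lemma adjC x y : adj G x y = adj G y x.
Proof. exact: adj_sym. Qed.

Lemma adj_neq x y : adj G x y -> x != y.
Proof. by case: eqP => // ->; rewrite (adj_irr G). Qed.

Lemma degin_card A x : degin A x = #|[set y in A | adj G x y]|.
Proof.
rewrite /degin -sum1_card [RHS](eq_bigl (fun y => (y \in A) && adj G x y)) => [|y].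
  by rewrite big_mkcondr; apply: eq_bigr => y _; case: adj.
by rewrite inE.
Qed.

Lemma degreeE x : degree G x = degin setT x.
Proof. by rewrite degin_card; apply: eq_card => y; rewrite !inE. Qed.

Lemma degin_split A B x : degin A x = degin (A :&: B) x + degin (A :\: B) x.
Proof. exact: big_setID. Qed.

Lemma deginU A B x : [disjoint A & B] -> degin (A :|: B) x = degin A x + degin B x.
Proof.
move=> dAB; rewrite (degin_split _ A) setUK; congr (_ + degin _ x).
apply/setP => y; rewrite !inE andb_orr andNb /=.
by case yB: (y \in B); rewrite ?andbF ?andbT // (disjointFl dAB yB).
Qed.

Lemma degin_sub A B x : A \subset B -> degin A x <= degin B x.
Proof. by move=> /setIidPr sAB; rewrite (degin_split B A) sAB leq_addr. Qed.

Lemma degin_exchange A B : \sum_(x in A) degin B x = \sum_(x in B) degin A x.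
Proof.
rewrite exchange_big; apply: eq_bigr => y _; apply: eq_bigr => x _.
by rewrite adjC.
Qed.

Lemma degin_gt0P A x : reflect (exists2 y, y \in A & adj G x y) (0 < degin A x).
Proof.
rewrite degin_card; apply: (iffP card_gt0P) => [[y]|[y yA xy]].
  by rewrite inE => /andP[yA xy]; exists y.
by exists y; rewrite inE yA.
Qed.

Lemma degin_gt1P A x :
  reflect (exists y z, [/\ y \in A, z \in A, y != z, adj G x y & adj G x z])
          (1 < degin A x).
Proof.
rewrite degin_card; apply: (iffP card_gt1P) => [[y [z []]]|[y [z [yA zA yz xy xz]]]].
  by rewrite !inE => /andP[yA xy] /andP[zA xz] yz; exists y, z.
by exists y, z; rewrite !inE yA zA.
Qed.

Lemma degin_gt2P A x :
  reflect (exists y z t, [/\ y \in A, z \in A & t \in A] /\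
     [/\ y != z, z != t, t != y, adj G x y & adj G x z /\ adj G x t])
    (2 < degin A x).
Proof.
rewrite degin_card; apply: (iffP card_gt2P) => [[y [z [t []]]]|[y [z [t []]]]].
  by rewrite !inE => -[/andP[yA xy] /andP[zA xz] /andP[tA xt]] [yz zt ty]; exists y, z, t.
by move=> [yA zA tA] [yz zt ty xy [xz xt]]; exists y, z, t; rewrite !inE yA zA tA.
Qed.

Lemma degin_le1 A x y z :
  degin A x <= 1 -> y \in A -> z \in A -> adj G x y -> adj G x z -> y = z.
Proof.
move=> le1 yA zA xy xz; apply: contraTeq le1 => yz; rewrite -ltnNge.
by apply/degin_gt1P; exists y, z.
Qed.

Lemma degin_le2 A x y z t :
  degin A x <= 2 -> [/\ y \in A, z \in A & t \in A] -> y != z ->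
  [&& adj G x y, adj G x z & adj G x t] -> t = y \/ t = z.
Proof.
move=> le2 [yA zA tA] yz /and3P[xy xz xt].
case: (eqVneq t y) => [->|ty]; first by left.
case: (eqVneq t z) => [->|tz]; first by right.
move: le2; rewrite leqNgt => /negP[].
by apply/degin_gt2P; exists y, z, t; rewrite yA zA tA yz xy xz xt ty eq_sym tz.
Qed.

Lemma degin_eq0 A x y : degin A x = 0 -> y \in A -> adj G x y = false.
Proof.
by move=> dx yA; apply/negP => xy; have /degin_gt0P : exists2 z, z \in A & adj G x z;
  [exists y | rewrite dx].
Qed.

(** Each edge inside [S] is counted once, at its end of smaller [enum_rank]. *)
Definition edges_in S : nat :=
  \sum_(x in S) \sum_(y in S | enum_rank x < enum_rank y) adj G x y.

Lemma handshake_in S : \sum_(x in S) degin S x = 2 * edges_in S.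
Proof.
rewrite mul2n -addnn {2}/edges_in.
rewrite [X in _ = _ + X](exchange_big_dep (mem S)) /=; last by move=> x y _ /andP[].
rewrite -big_split; apply: eq_bigr => x xS /=; rewrite /degin.
rewrite (bigID (fun y => enum_rank x < enum_rank y)) /=; congr (_ + _).
rewrite (bigD1 x) ?xS ?ltnn //= (adj_irr G) add0n.
apply: eq_big => [y|y _]; last by rewrite adjC.
case yS: (y \in S) => //=; rewrite -leqNgt ltn_neqAle andbC; congr (_ && _).
by rewrite -(inj_eq enum_rank_inj).
Qed.

Lemma card_edges : #|edges G| = edges_in setT.
Proof.
pose P := [set p : V * V | (enum_rank p.1 < enum_rank p.2) && adj G p.1 p.2].
have -> : edges G = [set [set p.1; p.2] | p in P].
  apply/setP => e; apply/imset2P/imsetP => [[x y _ xy ->]|[[x y]]].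
    have xy' : adj G x y by [].
    case: (ltngtP (enum_rank x) (enum_rank y)) => h.
    - by exists (x, y); rewrite // inE h.
    - by exists (y, x); rewrite ?inE /= ?h 1?adjC // setUC.
    - by move: (adj_neq xy'); rewrite (enum_rank_inj (val_inj h)) eqxx.
  by rewrite inE => /andP[_ /= xy] ->; exists x y.
rewrite card_in_imset => [|[x y] [x' y']]; last first.
  rewrite !inE /= => /andP[lt _] /andP[lt' _] eqe.
  have := set21 x y; have := set22 x y; rewrite eqe !inE.
  move=> /orP[]/eqP ? /orP[]/eqP ?; subst => //.
  - by rewrite ltnn in lt.
  - by have := ltn_trans lt lt'; rewrite ltnn.
  - by rewrite ltnn in lt.
have -> : #|P| = \sum_(p in P) 1 by rewrite sum1_card.
rewrite /edges_in pair_big_dep /=.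
rewrite (eq_bigl (fun p : V * V => (enum_rank p.1 < enum_rank p.2) && adj G p.1 p.2)).
  rewrite big_mkcondr; apply: eq_big => [[x y]|[x y] _] /=; first by rewrite !inE.
  by case: adj.
by move=> p; rewrite inE.
Qed.

Lemma handshake : \sum_x degree G x = 2 * #|edges G|.
Proof.
rewrite card_edges -handshake_in; apply: eq_big => [x|x _]; first by rewrite inE.
exact: degreeE.
Qed.

End Degrees.

(** * Links between nonadjacent vertices *)

Section Saturation.
Variables (V : finType) (G : sgraph V).
Implicit Types (u v w a b p q : V).

Let rep (p1 p2 p3 q1 q2 q3 : V) (s : 'I_3 + 'I_3) : V :=
  match s with
  | inl i => tnth [tuple p1; p2; p3] i
  | inr j => tnth [tuple q1; q2; q3] j
  end.

(** The two sides are disjoint because adjacency is irreflexive, so injectivity comes from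
    distinctness within each side. *)
Lemma contains_K33 (H : sgraph V) p1 p2 p3 q1 q2 q3 :
  uniq [:: p1; p2; p3] -> uniq [:: q1; q2; q3] ->
  all (fun p => all (adj H p) [:: q1; q2; q3]) [:: p1; p2; p3] ->
  contains (Kbip 3 3) H.
Proof.
move=> up uq /allP adjpq; exists (rep p1 p2 p3 q1 q2 q3).
have adjlr i j : adj H (tnth [tuple p1; p2; p3] i) (tnth [tuple q1; q2; q3] j).
  by have /allP := adjpq _ (mem_tnth i [tuple p1; p2; p3]); apply; apply: mem_tnth.
split=> [[i|i] [j|j] /= eqij|[i|i] [j|j] //= _].
- congr inl; apply/val_inj/eqP.
  by rewrite -(nth_uniq p1 (s := [:: p1; p2; p3])) //= -!(tnth_nth _ [tuple p1; p2; p3]) eqij.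
- by case/eqP: (adj_neq (adjlr i j)).
- by case/eqP: (adj_neq (adjlr j i)); rewrite eqij.
- congr inr; apply/val_inj/eqP.
  by rewrite -(nth_uniq q1 (s := [:: q1; q2; q3])) //= -!(tnth_nth _ [tuple q1; q2; q3]) eqij.
- by rewrite adjC; apply: adjlr.
Qed.

Lemma I3_others (i : 'I_3) : exists j k : 'I_3, [/\ j != i, k != i & j != k].
Proof.
case: i => [[|[|[|//]]] lt3].
- by exists (@Ordinal 3 1 isT), (@Ordinal 3 2 isT).
- by exists (@Ordinal 3 0 isT), (@Ordinal 3 2 isT).
- by exists (@Ordinal 3 0 isT), (@Ordinal 3 1 isT).
Qed.

(* For a non-edge uv: adding uv creates a K_{3,3} with parts {u, a1, a2} and
   {v, b1, b2}. *)
Definition link u v : Prop := exists a1 a2 b1 b2,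
  [/\ a1 != a2, b1 != b2, adj G v a1 && adj G v a2, adj G u b1 && adj G u b2 &
      [&& adj G a1 b1, adj G a1 b2, adj G a2 b1 & adj G a2 b2]].

Lemma linkC u v : link u v -> link v u.
Proof.
move=> [a1 [a2 [b1 [b2 [na nb va ub /and4P[h1 h2 h3 h4]]]]]].
exists b1, b2, a1, a2; split=> //.
by rewrite !(adjC G b1) !(adjC G b2) h1 h2 h3 h4.
Qed.

Lemma compl_edge u v : u != v -> ~~ adj G u v -> [set u; v] \in edges (compl G).
Proof.
by move=> uv nuv; apply/imset2P; exists u v; rewrite // unfold_in /= /compl_rel uv.
Qed.

Lemma saturated_link u v :
  saturated (Kbip 3 3) G -> u != v -> ~~ adj G u v -> link u v.
Proof.
move=> [freeG satG] uv nuv.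
have [f [finj fadj]] := satG _ (compl_edge uv nuv).
(* The copy uses the new edge, for otherwise it would already lie in [G]. *)
have /existsP[i /existsP[j eij]] :
    [exists i : 'I_3, exists j : 'I_3, [set u; v] == [set f (inl i); f (inr j)]].
  apply: contraT => /existsPn noe; exfalso; apply: freeG; exists f; split=> // x y xy.
  have := fadj _ _ xy; rewrite /= /add_edge_rel => /orP[//|/andP[_ exy]].
  case: x y xy exy => [i|i] [j|j] //= _ exy.
    by case/negP: (noe i); apply/existsP; exists j.
  by case/negP: (noe j); apply/existsP; exists i; rewrite [X in _ == X]setUC.
have [i1 [i2 [i1i i2i i12]]] := I3_others i.
have [j1 [j2 [j1j j2j j12]]] := I3_others j.
have fneq (s t : 'I_3 + 'I_3) : s != t -> f s != f t by apply: contra_neq; apply: finj.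
(* By injectivity the other eight edges of the copy differ from [uv]. *)
have in_G (i' j' : 'I_3) : (i' != i) || (j' != j) -> adj G (f (inl i')) (f (inr j')).
  move=> ij; have /orP[//|/andP[_]] := fadj (inl i') (inr j') isT.
  rewrite (eqP eij) => /eqP eqs; exfalso.
  have := set21 (f (inl i')) (f (inr j')); have := set22 (f (inl i')) (f (inr j')).
  rewrite -eqs !inE !(inj_eq finj) /= => /eqP[ej] /orP[/eqP[ei]|//].
  by move: ij; rewrite ei ej !eqxx.
have key : link (f (inl i)) (f (inr j)).
  exists (f (inl i1)), (f (inl i2)), (f (inr j1)), (f (inr j2)).
  split; rewrite ?(adjC G (f (inr j))) ?in_G ?i1i ?i2i ?j1j ?j2j ?orbT //.
  - by rewrite (inj_eq finj) /=; apply: contra_neq i12 => -[].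
  - by rewrite (inj_eq finj) /=; apply: contra_neq j12 => -[].
have := set21 u v; have := set22 u v; rewrite (eqP eij) !inE.
move=> /orP[]/eqP ev /orP[]/eqP eu.
- by move: uv; rewrite ev eu eqxx.
- by rewrite eu ev; apply: linkC.
- by rewrite eu ev.
- by move: uv; rewrite ev eu eqxx.
Qed.

Lemma link_contains u v : u != v -> ~~ adj G u v -> link u v ->
  contains (Kbip 3 3) (add_edge G [set u; v]).
Proof.
move=> uv nuv [a1 [a2 [b1 [b2 [na nb /andP[va1 va2] /andP[ub1 ub2] /and4P[h1 h2 h3 h4]]]]]].
apply: (@contains_K33 _ u a1 a2 v b1 b2).
- rewrite /= !inE na !negb_or andbT; apply/andP; split=> //.
  by apply/andP; split; apply: contraNneq nuv => ->; rewrite adjC.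
- rewrite /= !inE nb !negb_or andbT; apply/andP; split=> //.
  by apply/andP; split; apply: contraNneq nuv => ->.
- rewrite /= /add_edge_rel uv eqxx orbT ub1 ub2 h1 h2 h3 h4.
  by rewrite !(adjC G _ v) va1 va2.
Qed.

(** The converse of [saturated_link], used to certify the extremal graphs. *)
Lemma saturatedP :
  ~ contains (Kbip 3 3) G -> (forall u v, u != v -> ~~ adj G u v -> link u v) ->
  saturated (Kbip 3 3) G.
Proof.
move=> freeG linkG; split=> // e /imset2P[u v _ /andP[uv nuv] ->].
exact/link_contains/linkG.
Qed.

End Saturation.

(** * The neighbourhood of a vertex and its non-neighbours *)

(* [lia] splits on every boolean hypothesis in sight, so the graph ones are
   cleared first. *)
Ltac glia :=
  repeat match goal with
  | H : is_true (adj _ _ _) |- _ => clear H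
  | H : adj _ _ _ = _ |- _ => clear H
  | H : is_true (~~ adj _ _ _) |- _ => clear H
  | H : is_true (_ \in _) |- _ => clear H
  | H : is_true (_ \notin _) |- _ => clear H
  | H : is_true (~~ (?x == _)) |- _ =>
      lazymatch type of x with nat => fail | _ => clear H end
  end; lia.

(** Many contradictions below evaluate a charge on a few named distinct vertices. *)
Lemma sum_ge_seq (T : finType) (A : {set T}) (f : T -> nat) (s : seq T) :
  uniq s -> all (mem A) s -> \sum_(x <- s) f x <= \sum_(x in A) f x.
Proof.
move=> us /allP sA; rewrite big_uniq // [leqRHS](bigID (mem s)) /=.
apply: leq_trans (leq_addr _ _); rewrite [leqRHS](eq_bigl (mem s)) // => x.
by rewrite /= andbC; case xs: (x \in s) => //=; have /= -> := sA x xs.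
Qed.

Lemma sum_ge_const (T : finType) (A : {set T}) (f : T -> nat) c :
  (forall x, x \in A -> c <= f x) -> c * #|A| <= \sum_(x in A) f x.
Proof. by move=> h; rewrite mulnC -sum_nat_const; apply: leq_sum. Qed.

Lemma sum_if_sub (T : finType) (A B : {set T}) (f : T -> nat) :
  B \subset A -> \sum_(x in A) (if x \in B then f x else 0) = \sum_(x in B) f x.
Proof.
move=> /subsetP sBA; rewrite -big_mkcondr; apply: eq_bigl => x.
by case xB: (x \in B); rewrite ?andbF // sBA.
Qed.

Section Center.
Variables (V : finType) (G : sgraph V) (v : V).
Implicit Types (w x y a b p q u : V).

Definition nbh : {set V} := [set w | adj G v w].
Definition far : {set V} := ~: (v |: nbh).
Definition thick : {set V} := [set w in far | 1 < degin G nbh w].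

Local Notation N := nbh.
Local Notation W := far.
Local Notation A := thick.
Local Notation dN := (degin G N).
Local Notation dW := (degin G W).
Local Notation dA := (degin G A).

Lemma nbhE w : (w \in N) = adj G v w. Proof. by rewrite inE. Qed.
Lemma farE w : (w \in W) = (w != v) && ~~ adj G v w.
Proof. by rewrite !inE negb_or. Qed.
Lemma thickE w : (w \in A) = (w \in W) && (1 < dN w). Proof. by rewrite inE. Qed.
Lemma thick_far w : w \in A -> w \in W. Proof. by rewrite thickE => /andP[]. Qed.

Lemma thick_sub : A \subset W. Proof. by apply/subsetP => w; apply: thick_far. Qed.

Lemma card_nbh : #|N| = degree G v. Proof. by []. Qed.

Lemma far_nadj w : w \in W -> adj G w v = false.
Proof. by rewrite farE adjC => /andP[_ /negbTE]. Qed.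

Lemma nbh_far x w : x \in N -> w \in W -> x != w.
Proof. by rewrite nbhE farE => vx /andP[_]; apply: contraNneq => <-. Qed.

Lemma center_cases x : [\/ x = v, x \in N | x \in W].
Proof.
rewrite farE nbhE; case: (eqVneq x v) => [->|_]; first by constructor 1.
by case: (adj G v x); [constructor 2 | constructor 3].
Qed.

Lemma sum_center (f : V -> nat) :
  \sum_x f x = f v + \sum_(x in N) f x + \sum_(w in W) f w.
Proof.
rewrite (bigID (mem (v |: N))) /=; congr (_ + _).
  by rewrite big_setU1 // nbhE (adj_irr G).
by apply: eq_bigl => x; rewrite in_setC.
Qed.

Lemma degree_center u : degree G u = adj G u v + dN u + dW u.
Proof.
rewrite degreeE /degin -[RHS](sum_center (fun y => adj G u y : nat)).
by apply: eq_bigl => y; rewrite inE.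
Qed.

Lemma degree_nbh x : x \in N -> degree G x = 1 + dN x + dW x.
Proof. by rewrite nbhE => vx; rewrite degree_center adjC vx. Qed.

Lemma degree_far w : w \in W -> degree G w = dN w + dW w.
Proof. by move=> wW; rewrite degree_center far_nadj. Qed.

Lemma card_center : #|V| = 1 + #|N| + #|W|.
Proof.
have -> : #|V| = \sum_(x : V) 1 by rewrite sum1_card.
by rewrite (sum_center (fun=> 1)) !sum1_card.
Qed.

(** Twice the number of edges inside [N]. *)
Definition inner : nat := \sum_(x in N) dN x.

(** Both ends of the edges between [N] and [W] are counted from [W], whence the coefficient 2 of
    [dN w]. *)
Lemma edges_center :
  2 * #|edges G| = 2 * #|N| + inner + \sum_(w in W) (2 * dN w + dW w).
Proof.
rewrite -handshake sum_center -card_nbh.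
rewrite [X in _ + X + _](eq_bigr (fun x => 1 + dN x + dW x)) => [|x]; last exact: degree_nbh.
rewrite [X in _ + X](eq_bigr (fun w => dN w + dW w)) => [|w]; last exact: degree_far.
rewrite !big_split /= sum1_card (degin_exchange G N W).
rewrite [\sum_(i in W) 0]big1 // /inner; lia.
Qed.

(** Together with [far_even], this parity sharpens the strict bounds assumed in the discharging
    arguments. *)
Lemma inner_even : ~~ odd inner.
Proof. by rewrite /inner handshake_in oddM. Qed.

Lemma far_even : ~~ odd (\sum_(w in W) (2 * dN w + dW w)).
Proof.
have := inner_even; have := edges_center.
move: inner (\sum_(w in W) _) => a b; lia.
Qed.

Lemma thick_exchange : \sum_(a in A) dW a = \sum_(w in W) dA w.
Proof. exact: degin_exchange. Qed.

Lemma inner_C4 p q x y :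
  p != q -> x != y -> [/\ p \in N, q \in N, x \in N & y \in N] ->
  [&& adj G p x, adj G p y, adj G q x & adj G q y] -> 8 <= inner.
Proof.
move=> pq xy [pN qN xN yN] /and4P[px py qx qy].
have le2 z s t : s \in N -> t \in N -> s != t -> adj G z s -> adj G z t -> 1 < dN z.
  by move=> *; apply/degin_gt1P; exists s, t.
apply: leq_trans (sum_ge_seq (s := [:: p; q; x; y]) _ _ _).
- rewrite !big_cons big_nil.
  have := le2 p x y; have := le2 q x y; have := le2 x p q; have := le2 y p q.
  rewrite !(adjC G x) !(adjC G y) => /(_ pN qN pq py qy) ? /(_ pN qN pq px qx) ?.
  by move=> /(_ xN yN xy qx qy) ? /(_ xN yN xy px py) ?; lia.
- rewrite /= !inE xy !negb_or pq.
  by rewrite (adj_neq px) (adj_neq py) (adj_neq qx) (adj_neq qy).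
- by rewrite /= pN qN xN yN.
Qed.

Lemma inner_ge2 x : x \in N -> 2 * dN x <= inner.
Proof.
move=> xN; rewrite /inner (bigD1 x) //= mul2n -addnn leq_add2l.
rewrite {1}/degin (bigD1 x) //= (adj_irr G) add0n; apply: leq_sum => y /andP[yN yx].
by case xy: (adj G x y) => //; apply/degin_gt0P; exists x; rewrite // adjC.
Qed.

Hypothesis satG : saturated (Kbip 3 3) G.

Definition link_thick w : Prop := exists a b p q,
  [/\ a != b, p != q, [/\ a \in A, b \in A, p \in N & q \in N],
      adj G w a && adj G w b & [&& adj G a p, adj G a q, adj G b p & adj G b q]].

Definition link_mixed w : Prop := exists x a p q,
  [/\ p != q, [/\ x \in N, a \in A, p \in N & q \in N],
      adj G w x && adj G w a & [&& adj G x p, adj G x q, adj G a p & adj G a q]].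

Definition link_inner w : Prop := exists x y p q,
  [/\ x != y, p != q, [/\ x \in N, y \in N, p \in N & q \in N],
      adj G w x && adj G w y & [&& adj G x p, adj G x q, adj G y p & adj G y q]].

(** In a link of [v] and [w], the two neighbours of [w] are both adjacent to [p] and [q] in [N], so
    each lies in [N] or in [A]. *)
Lemma far_link w : w \in W -> [\/ link_thick w, link_mixed w | link_inner w].
Proof.
move=> wW; have := wW; rewrite farE eq_sym => /andP[vw nvw].
have [a [b [p [q [ab pq /andP[wa wb] /andP[vp vq] /and4P[ap aq bp bq]]]]]] :=
  saturated_link satG vw nvw.
have pN : p \in N by rewrite nbhE.
have qN : q \in N by rewrite nbhE.
have NA c : adj G w c -> adj G c p -> adj G c q -> c \in N \/ c \in A.
  move=> wc cp cq; case: (center_cases c) => [cv|cN|cW]; first 1 last.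
  - by left.
  - by right; rewrite thickE cW /=; apply/degin_gt1P; exists p, q.
  - by rewrite cv far_nadj in wc.
case: (NA a) => // aS; case: (NA b) => // bS.
- by constructor 3; exists a, b, p, q; rewrite wa wb ap aq bp bq.
- by constructor 2; exists a, b, p, q; rewrite wa wb ap aq bp bq.
- by constructor 2; exists b, a, p, q; rewrite wa wb ap aq bp bq.
- by constructor 1; exists a, b, p, q; rewrite wa wb ap aq bp bq.
Qed.

Lemma link_thick_dA w : link_thick w -> 1 < dA w.
Proof.
by move=> [a [b [p [q [ab _ [aA bA _ _] /andP[wa wb] _]]]]]; apply/degin_gt1P; exists a, b.
Qed.

Lemma link_mixed_dA w : link_mixed w -> 0 < dA w.
Proof. by move=> [x [a [p [q [_ [_ aA _ _] /andP[_ wa] _]]]]]; apply/degin_gt0P; exists a. Qed.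

Lemma link_mixed_dN w : link_mixed w -> exists x, [/\ x \in N, adj G w x & 1 < dN x].
Proof.
move=> [x [a [p [q [pq [xN _ pN qN] /andP[wx _] /and4P[xp xq _ _]]]]]].
by exists x; split=> //; apply/degin_gt1P; exists p, q.
Qed.

Lemma link_innerN w : inner <= 7 -> ~ link_inner w.
Proof.
move=> le7 [x [y [p [q [xy pq [xN yN pN qN] _ h]]]]].
by have := inner_C4 xy pq (And4 xN yN pN qN) h; rewrite leqNgt ltnS le7.
Qed.

Lemma dN0_link w : w \in W -> dN w = 0 -> link_thick w.
Proof.
move=> wW dw; case: (far_link wW) => // [[x [a [p [q [_ [xN _ _ _] /andP[wx _] _]]]]]|].
  by rewrite (degin_eq0 dw xN) in wx.
move=> [x [y [p [q [_ _ [xN _ _ _] /andP[wx _] _]]]]].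
by rewrite (degin_eq0 dw xN) in wx.
Qed.

(* The pair (a, x) for x isolated in N: if no far vertex has three neighbours
   in N, then some far neighbour of a is adjacent to two far neighbours of x. *)
Lemma thick_link a x :
  a \in W -> x \in N -> ~~ adj G a x -> dN x = 0 ->
  (forall w, w \in W -> dN w <= 2) ->
  exists r p q, [/\ r \in W, p \in W /\ q \in W, p != q,
     [/\ adj G a r, adj G r p & adj G r q] & adj G x p /\ adj G x q].
Proof.
move=> aW xN nax dx le2; have ax : a != x by rewrite eq_sym nbh_far.
have [p [q [r [s [pq rs /andP[xp xq] /andP[ar as_] /and4P[pr ps qr qs]]]]]] :=
  saturated_link satG ax nax.
have pv : (p = v) \/ (p \in W).
  by case: (center_cases p) => [|pN|]; [left | rewrite (degin_eq0 dx pN) in xp | right].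
have qv : (q = v) \/ (q \in W).
  by case: (center_cases q) => [|qN|]; [left | rewrite (degin_eq0 dx qN) in xq | right].
have noN u : u \in W -> adj G u x -> adj G u r -> adj G u s ->
    r != x -> s != x -> r \in N -> s \in N -> False.
  move=> uW ux ur us_ rx sx rN sN; have := le2 _ uW; rewrite leqNgt => /negP; apply.
  by apply/degin_gt2P; exists x, r, s; rewrite xN rN sN ux ur us_ eq_sym rx rs.
have rx : r != x by apply: contraNneq nax => <-.
have sx : s != x by apply: contraNneq nax => <-.
have rvN : r != v by apply: contraTneq ar => ->; rewrite far_nadj.
have svN : s != v by apply: contraTneq as_ => ->; rewrite far_nadj.
(* If one of [p], [q] is [v], then [r] and [s] lie in [N], and the other one sees [x], [r] and [s]
   there. *)
case: pv => [pv|pW].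
  have rN : r \in N by rewrite nbhE -pv.
  have sN : s \in N by rewrite nbhE -pv.
  case: qv => [qv|qW]; first by rewrite pv qv eqxx in pq.
  by case: (noN q); rewrite // adjC.
case: qv => [qv|qW].
  have rN : r \in N by rewrite nbhE -qv.
  have sN : s \in N by rewrite nbhE -qv.
  by case: (noN p); rewrite // adjC.
case: (center_cases r) => [rv|rN|rW]; first by rewrite rv eqxx in rvN.
- case: (center_cases s) => [sv|sN|sW]; first by rewrite sv eqxx in svN.
    by case: (noN p); rewrite // adjC.
  by exists s, p, q; rewrite !(adjC G s) ps qs.
- by exists r, p, q; rewrite !(adjC G r) pr qr.
Qed.

End Center.

(** * Minimum degree 3 *)

Section Three.
Variables (V : finType) (G : sgraph V) (v : V).
Hypothesis satG : saturated (Kbip 3 3) G.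
Hypothesis min3 : forall u, 3 <= degree G u.
Hypothesis dv : degree G v = 3.

Local Notation N := (nbh G v).
Local Notation W := (far G v).
Local Notation A := (thick G v).
Local Notation dN := (degin G N).
Local Notation dW := (degin G W).
Local Notation dA := (degin G A).
Local Notation S := (\sum_(w in W) (2 * dN w + dW w)).

Lemma far3 w : w \in W -> 3 <= dN w + dW w.
Proof. by move=> wW; rewrite -degree_far. Qed.

Lemma uniq_nbh (s : seq V) : uniq s -> all (mem N) s -> size s <= 3.
Proof.
move=> us sN; have := sum_ge_seq (fun=> 1) us sN.
by rewrite !sum1_card card_nbh dv big_const_seq count_predT iter_addn_0 mul1n.
Qed.

(** A 4-cycle does not fit into the three vertices of [N]. *)
Lemma far_links3 w : w \in W -> link_thick G v w \/ link_mixed G v w.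
Proof.
move=> wW; case: (far_link satG wW); [by left | by right |].
move=> [x [y [p [q [xy pq [xN yN pN qN] _ /and4P[xp xq yp yq]]]]]].
have := @uniq_nbh [:: x; y; p; q]; rewrite /= !inE !negb_or xy pq.
rewrite (adj_neq xp) (adj_neq xq) (adj_neq yp) (adj_neq yq) -!nbhE xN yN pN qN.
by move=> /(_ isT isT).
Qed.

Lemma dA_gt0_3 w : w \in W -> 0 < dA w.
Proof. by move=> /far_links3[/link_thick_dA/ltnW|/link_mixed_dA]. Qed.

(* The pair (a, s) for s in N: otherwise both common neighbours on the side of a
   lie in N, and a vertex other than v adjacent to them and to s would see all of N. *)
Lemma far_pair a s : (forall w, w \in W -> dN w <= 2) ->
  a \in W -> s \in N -> ~~ adj G a s ->
  exists r p q, [/\ r \in W, p != q, adj G a r, adj G r p && adj G r q &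
                    adj G s p && adj G s q].
Proof.
move=> k2 aW sN nas; have as' : a != s by rewrite eq_sym (nbh_far sN aW).
have [p [q [r [t [pq rt /andP[sp sq] /andP[ar at'] /and4P[pr pt qr qt]]]]]] :=
  saturated_link satG as' nas.
have side u : adj G a u -> u \in N \/ u \in W.
  move=> au; case: (center_cases G v u) => [uv|uN|uW]; [|by left|by right].
  by rewrite uv (far_nadj aW) in au.
case: (side r ar) => [rN|rW]; last first.
  by exists r, p, q; rewrite rW sp sq !(adjC G r) pr qr.
case: (side t at') => [tN|tW]; last first.
  by exists t, p, q; rewrite tW sp sq !(adjC G t) pt qt.
have sr : s != r by apply: contraNneq nas => ->.
have st : s != t by apply: contraNneq nas => ->.
have onlyv u : adj G s u -> adj G u r -> adj G u t -> u = v.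
  move=> su ur ut; case: (center_cases G v u) => [//|uN|uW].
    have := @uniq_nbh [:: u; s; r; t].
    rewrite /= !inE !negb_or sr st rt [u == s]eq_sym (adj_neq su) (adj_neq ur) (adj_neq ut).
    by rewrite -!nbhE uN sN rN tN => /(_ isT isT).
  have := k2 u uW; rewrite leqNgt => /negP[]; apply/degin_gt2P; exists s, r, t.
  by rewrite sN rN tN sr rt eq_sym st adjC su ur ut.
by rewrite (onlyv p sp pr pt) (onlyv q sq qr qt) eqxx in pq.
Qed.

(** This says that there are fewer than [2 * #|V|] edges, as [2 * #|edges G|] is [6 + inner G v + S]
    and [#|V|] is [4 + #|W|]. *)
Hypothesis small : inner G v + S < 10 + 4 * #|W|.
Hypothesis far_neq0 : W != set0.

(* What is left of 2 * dN w + dW w - 4 once every vertex of A has passed 1 along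
   each of its edges into W. *)
Definition cost3 w : nat :=
  if w \in A then 2 * (dN w - 2) + dA w
  else if dN w == 1 then dW w + dA w - 2 else dW w + dA w - 4.

(** By parity the strict bound 10 drops to 8; the charges passed from [A] to [W] cancel by
    [thick_exchange]. *)
Lemma cost3_sum : \sum_(w in W) cost3 w + inner G v <= 8.
Proof.
suff h : 4 * #|W| + \sum_(w in W) cost3 w <= S.
  by have := inner_even G v; have := far_even G v; move: h small; glia.
rewrite -(leq_add2r (\sum_(a in A) dW a)) {2}thick_exchange.
rewrite -(sum_if_sub _ (thick_sub G v)) mulnC -sum_nat_const -!big_split.
apply: leq_sum => w wW /=; rewrite /cost3.
have := far3 wW; have := dA_gt0_3 wW; rewrite thickE wW /=.
case: (eqVneq (dN w) 0) => [d0|].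
  by have := link_thick_dA (dN0_link satG wW d0); rewrite d0 /=; glia.
by case: ifP; [|case: (dN w =P 1)]; glia.
Qed.

Lemma cost3_seq s : uniq s -> all (mem W) s ->
  \sum_(w <- s) cost3 w + inner G v <= 8.
Proof. by move=> us sW; apply: leq_trans cost3_sum; rewrite leq_add2r sum_ge_seq. Qed.

(** With [cost3_sum] this leaves [W] at most eight vertices, so a few named vertices soon exhaust
    it. *)
Lemma cost3_gt0 w : w \in W -> 0 < cost3 w.
Proof.
move=> wW; have := far3 wW; have := dA_gt0_3 wW; rewrite /cost3 thickE wW /=.
case: (eqVneq (dN w) 0) => [d0|].
  by have := link_thick_dA (dN0_link satG wW d0); rewrite d0 /=; glia.
by case: ifP; [|case: (dN w =P 1)]; glia.
Qed.

Lemma cost3_thick w : w \in A -> cost3 w = 2 * (dN w - 2) + dA w.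
Proof. by rewrite /cost3 => ->. Qed.

Lemma dN_thick w : w \in A -> 1 < dN w.
Proof. by rewrite thickE => /andP[]. Qed.

Lemma thick_ex : exists a, a \in A.
Proof.
have /set0Pn[w wW] := far_neq0.
by have /degin_gt0P[a aA _] := dA_gt0_3 wW; exists a.
Qed.

Lemma non_nbr a : dN a <= 2 -> exists2 s, s \in N & ~~ adj G a s.
Proof.
move=> k2; apply/exists_inP; apply: contraT; rewrite negb_exists_in => /forall_inP h.
have : 1 * #|N| <= dN a by apply: sum_ge_const => x /h; case: adj.
by rewrite card_nbh dv; glia.
Qed.

(** The costs sum to at most 2, so [W] consists of two adjacent vertices [a], [a'] of [A], each with
    two neighbours in [N]. The mixed link of [a'] gives [x] in [N] not adjacent to [a], and linking
    [a] to [x] gives [a'] a third neighbour in [N]. *)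
Lemma three_triangle : 6 <= inner G v -> False.
Proof.
move=> ge6; have [a aA] := thick_ex; have aW := thick_far aA.
have /degin_gt0P[a' a'A aa'] := dA_gt0_3 aW; have a'W := thick_far a'A.
have naa' := adj_neq aa'.
have ca := cost3_gt0 aW; have ca' := cost3_gt0 a'W.
have onlyW w : w \in W -> w = a \/ w = a'.
  move=> wW; case: (eqVneq w a) => [|wa]; first by left.
  case: (eqVneq w a') => [|wa']; first by right.
  have := @cost3_seq [:: w; a; a']; rewrite !big_cons big_nil /= wW aW a'W !inE negb_or.
  by rewrite wa wa' naa' => /(_ isT isT); have := cost3_gt0 wW; glia.
have := @cost3_seq [:: a; a']; rewrite !big_cons big_nil /= aW a'W !inE naa'.
move=> /(_ isT isT); rewrite cost3_thick // in ca *; rewrite cost3_thick // in ca' *.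
have := dA_gt0_3 aW; have := dA_gt0_3 a'W; have := dN_thick aA; have := dN_thick a'A.
move=> ka' ka da' da le2.
have {}ka : dN a = 2 by glia. have {}ka' : dN a' = 2 by glia.
have {}da : dA a <= 1 by glia. have {}da' : dA a' <= 1 by glia.
have k2 w : w \in W -> dN w <= 2 by move=> /onlyW[] ->; rewrite ?ka ?ka'.
case: (far_links3 a'W) => [/link_thick_dA|]; first by rewrite ltnNge da'.
move=> [x [b [p [q [pq [xN bA pN qN] /andP[a'x a'b] /and4P[xp xq bp bq]]]]]].
have ba : b = a by apply: (degin_le1 da' bA aA a'b); rewrite adjC.
rewrite {b bA a'b}ba in bp bq.
have nax : ~~ adj G a x.
  apply/negP => ax; have : 2 < dN a by apply/degin_gt2P; exists x, p, q;
    rewrite xN pN qN pq ax bp bq (adj_neq xp) eq_sym (adj_neq xq).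
  by rewrite ka.
have [r [s [t [rW st ar /andP[rs rt] /andP[xs xt]]]]] := far_pair k2 aW xN nax.
have ra' : r = a' by case: (onlyW r rW) => // ra; move: (adj_neq ar); rewrite ra eqxx.
rewrite {r rW ar}ra' in rs rt.
have inN u : adj G a' u -> adj G x u -> u \in N.
  move=> a'u xu; case: (center_cases G v u) => [uv||/onlyW[ua|ua]] //.
  - by rewrite uv (far_nadj a'W) in a'u.
  - by rewrite adjC -ua xu in nax.
  - by rewrite ua (adj_irr G) in a'u.
have : 2 < dN a'.
  apply/degin_gt2P; exists x, s, t; rewrite xN !inN // a'x rs rt st.
  by rewrite (adj_neq xs) eq_sym (adj_neq xt).
by rewrite ka'.
Qed.

(** [N] induces the path [y], [x], [z], so the costs sum to at most 4 and every mixed link uses [x]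
    with the pair [y], [z]. *)
Lemma three_path x : x \in N -> 1 < dN x -> inner G v <= 5 -> False.
Proof.
move=> xN /[dup] kx /degin_gt1P[y [z [yN zN yz xy xz]]] le5.
have nxy := adj_neq xy; have nxz := adj_neq xz.
have dy : 0 < dN y by apply/degin_gt0P; exists x; rewrite // adjC.
have dz : 0 < dN z by apply/degin_gt0P; exists x; rewrite // adjC.
have inN u : u \in N -> [\/ u = x, u = y | u = z].
  move=> uN; have := @uniq_nbh [:: u; x; y; z]; rewrite /= !inE !negb_or nxy nxz yz.
  rewrite -!nbhE uN xN yN zN.
  case: (eqVneq u x) => [->|_]; first by constructor 1.
  case: (eqVneq u y) => [->|_]; first by constructor 2.
  case: (eqVneq u z) => [->|_]; first by constructor 3.
  by move=> /(_ isT isT).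
have inner4 : inner G v = 4 /\ dN x + dN y + dN z <= 4.
  have := @sum_ge_seq _ N dN [:: x; y; z].
  rewrite !big_cons big_nil /= !inE negb_or nxy nxz yz -!nbhE xN yN zN => /(_ isT isT).
  by rewrite -/(inner G v); have := inner_even G v; glia.
case: inner4 => inner4 le4.
have only_x u : u \in N -> 1 < dN u -> u = x by case/inN => [//||] ->; glia.
have mixed w : link_mixed G v w -> adj G w x /\ exists2 a, a \in A & [&& adj G w a, adj G a y & adj G a z].
  move=> [u [a [p [q [pq [uN aA pN qN] /andP[wu wa] /and4P[up uq ap aq]]]]]].
  have ux : u = x by apply: only_x => //; apply/degin_gt1P; exists p, q.
  rewrite {u uN}ux in wu up uq; split=> //; exists a; rewrite // wa /=.
  have := adj_neq up; have := adj_neq uq; move: pq ap aq.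
  by case: (inN p pN) => ->; case: (inN q qN) => ->; rewrite ?eqxx //= => _ -> ->.
have costs s : uniq s -> all (mem W) s -> \sum_(w <- s) cost3 w <= 4.
  by move=> us sW; have := cost3_seq us sW; rewrite inner4; glia.
(* Otherwise a vertex of [A] and two of its neighbours in [A] would cost 2 each. *)
have [a aA da] : exists2 a, a \in A & dA a <= 1.
  apply/exists_inP; apply: contraT; rewrite negb_exists_in => /forall_inP h.
  have [a aA] := thick_ex; have := h a aA; rewrite -ltnNge => /degin_gt1P.
  move=> [b [c [bA cA bc ab ac]]].
  have := @costs [:: a; b; c]; rewrite !big_cons big_nil /= !thick_far //.
  rewrite !inE negb_or (adj_neq ab) (adj_neq ac) bc !cost3_thick //.
  have := h a aA; have := h b bA; have := h c cA; rewrite -!ltnNge => ha hb hc /(_ isT isT).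
  by glia.
have aW := thick_far aA.
case: (far_links3 aW) => [/link_thick_dA|/mixed[ax [a' a'A /and3P[aa' a'y a'z]]]].
  by rewrite ltnNge da.
have a'W := thick_far a'A; have naa' := adj_neq aa'.
have := @costs [:: a; a']; rewrite !big_cons big_nil /= aW a'W !inE naa' => /(_ isT isT).
have da1 := dA_gt0_3 aW; have da'1 := dA_gt0_3 a'W.
have ka := dN_thick aA; have ka' := dN_thick a'A.
rewrite !cost3_thick // => le4'.
(* If [a'] sees all of [N], the budget leaves it [a] as its only neighbour in [A]; its mixed link
   then makes [a] see all of [N] too, which costs too much. *)
case a'x: (adj G a' x).
  have ka3 : 2 < dN a'.
    by apply/degin_gt2P; exists x, y, z; rewrite xN yN zN nxy yz eq_sym nxz a'x a'y a'z.
  case: (far_links3 a'W) => [/link_thick_dA|/mixed[_ [b bA /and3P[a'b b_y b_z]]]]; first by glia.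
  have ba : b = a by apply: (@degin_le1 _ G A a') => //; [glia | rewrite adjC].
  rewrite {b bA a'b}ba in b_y b_z.
  have : 2 < dN a.
    by apply/degin_gt2P; exists x, y, z; rewrite xN yN zN nxy yz eq_sym nxz ax b_y b_z.
  by glia.
(* Now [a'] has a second neighbour [a2] in [A]; the costs 1, 2, 1 use up the budget, so [W] is {[a],
   [a'], [a2]}. *)
case: (far_links3 a'W) => [/link_thick_dA da'|/mixed[]]; last by rewrite a'x.
have /degin_gt1P[b [c [bA cA bc a'b a'c]]] := da'.
have [a2 [a2A a2a a'a2]] : exists a2, [/\ a2 \in A, a2 != a & adj G a' a2].
  case: (eqVneq b a) => [ba|ba]; last by exists b.
  by exists c; split=> //; rewrite -ba eq_sym.
have a2W := thick_far a2A; have na'a2 := adj_neq a'a2.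
have c2 := cost3_gt0 a2W.
have := @costs [:: a; a'; a2]; rewrite !big_cons big_nil /= aW a'W a2W !inE negb_or naa' na'a2.
rewrite eq_sym a2a !cost3_thick // => /(_ isT isT).
have da2 := dA_gt0_3 a2W; have ka2 := dN_thick a2A => le4''.
have onlyW w : w \in W -> [\/ w = a, w = a' | w = a2].
  move=> wW; case: (eqVneq w a) => [|wa]; first by constructor 1.
  case: (eqVneq w a') => [|wa']; first by constructor 2.
  case: (eqVneq w a2) => [|wa2]; first by constructor 3.
  have := @costs [:: w; a; a'; a2]; rewrite !big_cons big_nil /= wW aW a'W a2W.
  rewrite !inE !negb_or naa' na'a2 wa wa' wa2 [a == a2]eq_sym a2a !(@cost3_thick a, @cost3_thick a', @cost3_thick a2) //.
  by move=> /(_ isT isT); have := cost3_gt0 wW; glia.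
have k2 w : w \in W -> dN w <= 2 by case/onlyW => ->; glia.
have [s sN nas] := non_nbr (k2 a aW).
have [r [p [q [rW pq ar /andP[rp rq] /andP[sp sq]]]]] := far_pair k2 aW sN nas.
have rA : r \in A by case: (onlyW r rW) => ->.
have ra' : r = a' by apply: (degin_le1 da rA a'A ar aa').
rewrite {r rW rA ar}ra' in rp rq.
(* [a'] and [s] need two common neighbours, but only [a2] is available. *)
have only2 u : adj G a' u -> adj G s u -> u = a2.
  move=> a'u su; case: (center_cases G v u) => [uv|uN|/onlyW[ua|ua|//]].
  - by rewrite uv (far_nadj a'W) in a'u.
  - have : 1 < dN s \/ u = x.
      case: (eqVneq u x) => [->|ux]; [by right | left].
      have sx : s != x by apply: contraNneq nas => ->.
      apply/degin_gt1P; exists x, u; split; rewrite // 1?eq_sym // adjC.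
      by case: (inN s sN) => [e|->|->] //; rewrite e eqxx in sx.
    case=> [/(only_x s sN) sx|ux]; first by rewrite sx ax in nas.
    by rewrite ux a'x in a'u.
  - by rewrite adjC -ua su in nas.
  - by rewrite ua (adj_irr G) in a'u.
by rewrite (only2 p rp sp) (only2 q rq sq) eqxx in pq.
Qed.

(** No mixed link exists, so every vertex of [W] has two neighbours in [A] and every vertex of [A]
    costs at least 2. *)
Lemma three_flat : (forall x, x \in N -> dN x <= 1) -> False.
Proof.
move=> le1.
have thickL w : w \in W -> link_thick G v w.
  by move=> /far_links3[//|/link_mixed_dN[x [xN _]]]; rewrite ltnNge le1.
have dA2 w : w \in W -> 1 < dA w by move=> wW; apply/link_thick_dA/thickL.
have cost2 w : w \in A -> 2 <= cost3 w.
  by move=> wA; rewrite cost3_thick //; have := dA2 w (thick_far wA); glia.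
have nbrs a : a \in A -> exists b c, [/\ b \in A, c \in A, uniq [:: a; b; c], adj G a b & adj G a c].
  move=> aA; have /degin_gt1P[b [c [bA cA bc ab ac]]] := dA2 a (thick_far aA).
  by exists b, c; split; rewrite //= !inE negb_or (adj_neq ab) (adj_neq ac) bc.
have [a aA ka] : exists2 a, a \in A & dN a = 2.
  have [a aA] := thick_ex; have [b [c [bA cA abc _ _]]] := nbrs a aA.
  have := cost3_seq abc; rewrite !big_cons big_nil /= !thick_far // => /(_ isT).
  have := cost2 a aA; have := cost2 b bA; have := cost2 c cA.
  case: (eqVneq (dN a) 2) => [|na]; first by exists a.
  rewrite !cost3_thick //; have := dN_thick aA; have := dA2 a (thick_far aA).
  case: (eqVneq (dN b) 2) => [|nb]; first by exists b.
  by have := dN_thick bA; have := dA2 b (thick_far bA); glia.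
have aW := thick_far aA; have [b [c [bA cA abc ab ac]]] := nbrs a aA.
have ca := cost2 a aA; have cb := cost2 b bA; have cc := cost2 c cA.
have [z zN naz] : exists2 z, z \in N & ~~ adj G a z by apply: non_nbr; rewrite ka.
(* A fourth vertex [d] of [A] uses up the budget: [W] is {[d], [a], [b], [c]} and all costs are 2.
   Linking [a] to [z] then yields [r] with three neighbours in [A]. *)
case: (boolP [exists d in W, (d \in A) && (d \notin [:: a; b; c])]) => [|onlyA].
  move=> /exists_inP[d dW' /andP[dA' nd]].
  have cd := cost2 d dA'.
  have allW w : w \in W -> w \in [:: d; a; b; c].
    move=> wW; apply: contraT => nw.
    have := @cost3_seq [:: w; d; a; b; c]; rewrite !big_cons big_nil.
    rewrite cons_uniq nw cons_uniq nd abc /= wW dW' !thick_far // => /(_ isT isT).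
    by have := cost3_gt0 wW; glia.
  have allW' w : w \in W -> [\/ w = d, w = a, w = b | w = c].
    move=> /allW; rewrite !inE => /or4P[]/eqP ->;
    by [constructor 1 | constructor 2 | constructor 3 | constructor 4].
  have := @cost3_seq [:: d; a; b; c]; rewrite !big_cons big_nil cons_uniq nd abc /= dW' !thick_far //.
  move=> /(_ isT isT) le8.
  have tight w : w \in W -> [/\ w \in A, dN w <= 2, dA w <= 2 & inner G v = 0].
    move=> wW; have wA : w \in A.
      by case: (allW' w wW) => ->.
    have : cost3 w <= 2 by case: (allW' w wW) => ->; glia.
    by rewrite cost3_thick // => h; split=> //; have := dA2 w wW; glia.
  have [r [p [q [rW pq ar /andP[rp rq] /andP[zp zq]]]]] :=
    far_pair (fun w wW => let: And4 _ h _ _ := tight w wW in h) aW zN naz.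
  have [_ _ _ inner0] := tight a aW.
  have z0 : dN z = 0 by have := inner_ge2 zN; rewrite inner0; glia.
  have inA u : adj G r u -> adj G z u -> u \in A.
    move=> ru zu; case: (center_cases G v u) => [uv|uN|/tight[]//].
      by rewrite uv (far_nadj rW) in ru.
    by rewrite (degin_eq0 z0 uN) in zu.
  have [_ _ + _] := tight r rW; rewrite leqNgt => /negP; apply.
  apply/degin_gt2P; exists a, p, q; rewrite aA !inA // pq rp rq [adj G r a]adjC ar.
  split=> //; split=> //.
  - by apply: contraNneq naz => ->; rewrite adjC.
  - by apply: contraNneq naz => <-; rewrite adjC.
have inA w : w \in A -> w \in [:: a; b; c].
  move=> wA; apply: contraNT onlyA => nw.
  by apply/exists_inP; exists w; rewrite ?wA // thick_far.
(* [A] is now {[a], [b], [c]}. The thick link of its third vertex [t] gives [a] and [u] two common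
   neighbours in [N], and [z] is another neighbour of [u]. *)
have share u : u \in A -> adj G u z -> 2 < dN u.
  move=> uA uz.
  have nua : u != a by apply: contraNneq naz => <-.
  have [p [q [pq [pN qN] /and4P[ap aq up uq]]]] : exists p q,
      [/\ p != q, p \in N /\ q \in N & [&& adj G a p, adj G a q, adj G u p & adj G u q]].
    have [t tA [ta tu]] : exists2 t, t \in A & t != a /\ t != u.
      move: abc (inA u uA); rewrite /= !inE !negb_or => /and3P[/andP[nab nac] nbc _].
      rewrite (negbTE nua) /= => /orP[]/eqP ->.
      - by exists c; rewrite // ![c == _]eq_sym.
      - by exists b; rewrite // [b == a]eq_sym.
    have third s : s \in A -> s != t -> s = a \/ s = u.
      have us : uniq [:: t; a; u] by rewrite /= !inE negb_or ta tu eq_sym nua.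
      have sub : {subset [:: t; a; u] <= [:: a; b; c]}.
        by move=> s'; rewrite in_cons in_cons mem_seq1 => /or3P[]/eqP ->; apply: inA.
      have [_ eqs] := uniq_min_size us sub (leqnn 3).
      move=> /inA; rewrite -eqs in_cons in_cons mem_seq1.
      by move=> /or3P[]/eqP ->; rewrite ?eqxx //; [left | right].
    have [s [s' [p [q [ss' pq [sA s'A pN qN] /andP[ts ts'] /and4P[sp sq s'p s'q]]]]]] :=
      thickL t (thick_far tA).
    have := adj_neq ts; rewrite eq_sym => /(third s sA).
    have := adj_neq ts'; rewrite eq_sym => /(third s' s'A).
    move=> [e'|e'] [e|e]; rewrite {}e {}e' in ss' sp sq s'p s'q *.
    - by rewrite eqxx in ss'.
    - by exists p, q; rewrite sp sq s'p s'q.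
    - by exists p, q; rewrite sp sq s'p s'q.
    - by rewrite eqxx in ss'.
  apply/degin_gt2P; exists z, p, q; rewrite zN pN qN pq uz up uq; split=> //; split=> //.
  - by apply: contraNneq naz => ->.
  - by apply: contraNneq naz => <-.
(* Each far neighbour of [z] costs 2 on top of the 2 for each vertex of [A]; as [z] has degree at
   least 3, the budget is exceeded. *)
have low : \sum_(w in W) ((if w \in A then 2 else 0) + 2 * adj G z w) <= \sum_(w in W) cost3 w.
  apply: leq_sum => w wW; have := dA2 w wW; have := far3 wW; rewrite adjC.
  case: (boolP (w \in A)) => [wA|nA].
    by rewrite cost3_thick //; case wz: (adj G w z); [have := share w wA wz|]; glia.
  rewrite /cost3 (negbTE nA); case wz: (adj G w z); last by glia.
  have : 0 < dN w by apply/degin_gt0P; exists z.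
  by move: nA; rewrite thickE wW /=; case: (dN w =P 1); glia.
move: low; rewrite big_split /= (sum_if_sub (fun=> 2) (thick_sub G v)) sum_nat_const -big_distrr /=.
have A3 : 3 <= #|A|.
  have := @sum_ge_seq _ A (fun=> 1) [:: a; b; c] abc; rewrite /= aA bA cA => /(_ isT).
  by rewrite !big_cons big_nil sum1_card.
have := cost3_sum; have := min3 z; rewrite (degree_nbh zN) -/(dW z).
by have := le1 z zN; have := inner_ge2 zN; glia.
Qed.

Lemma three_contra : False.
Proof.
case: (leqP 6 (inner G v)) => [/three_triangle //|le5].
case: (boolP [exists x in N, 1 < dN x]) => [/exists_inP[x xN kx]|h].
  exact: (@three_path x).
apply: three_flat => x xN; rewrite leqNgt; apply: contraNN h => kx.
by apply/exists_inP; exists x.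
Qed.

End Three.

Lemma min3_edges (V : finType) (G : sgraph V) (v : V) :
  5 <= #|V| -> saturated (Kbip 3 3) G -> (forall u, 3 <= degree G u) ->
  degree G v = 3 -> 2 * #|V| <= #|edges G|.
Proof.
move=> n5 satG min3 dv; have cardV := card_center G v; rewrite card_nbh dv in cardV.
rewrite leqNgt; apply/negP => small; apply: (three_contra satG min3 dv).
  by have := edges_center G v; rewrite card_nbh dv; glia.
by rewrite -card_gt0; glia.
Qed.

(** * Minimum degree 5 *)

Section ThinDefs.
Variables (V : finType) (G : sgraph V) (v : V).
Definition thin : {set V} := [set w in far G v | degin G (nbh G v) w == 0].
(** In the discharging such a vertex has surplus [4 * 2 + 2 * 3 - 12 = 2] but owes 3. *)
Definition bad (a : V) : bool :=
  [&& a \in far G v, degin G (nbh G v) a == 2, degin G (far G v) a == 3 &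
      degin G thin a == 3].
End ThinDefs.

Section Five.
Variables (V : finType) (G : sgraph V).
Hypothesis satG : saturated (Kbip 3 3) G.

(** All far neighbours of [a] are thin, so none lies in [A]. *)
Lemma bad_link v a : bad G v a -> link_inner G v a.
Proof.
move=> /and4P[aW _ /eqP dWa /eqP dZa].
have sub : thin G v \subset far G v by apply/subsetP => w; rewrite inE => /andP[].
have := degin_split G (far G v) (thin G v) a; rewrite (setIidPr sub) dWa dZa.
rewrite -[LHS]addn0 => /addnI/esym far0.
have noA b : b \in thick G v -> ~~ adj G a b.
  rewrite thickE => /andP[bW kb]; rewrite (degin_eq0 far0) // inE bW andbT inE bW /=.
  by rewrite -lt0n ltnW.
case: (far_link satG aW) => //.
- by move=> [b [c [p [q [_ _ [bA _ _ _] /andP[ab _] _]]]]]; move: (noA b bA); rewrite ab.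
- by move=> [x [b [p [q [_ [_ bA _ _] /andP[_ ab] _]]]]]; move: (noA b bA); rewrite ab.
Qed.

(* The neighbourhood of a bad vertex splits into two nonadjacent parts of sizes
   2 and 3, so it contains no 4-cycle. *)
Lemma bad_center v a b : bad G v a -> ~~ bad G a b.
Proof.
move=> bad_a; apply/negP => /bad_link[x [y [p [q [xy pq [xa ya pa qa] _]]]]].
move=> /and4P[xp xq yp yq].
have /and4P[aW /eqP dNa /eqP dWa /eqP dZa] := bad_a.
have sub : thin G v \subset far G v by apply/subsetP => w; rewrite inE => /andP[].
have := degin_split G (far G v) (thin G v) a; rewrite (setIidPr sub) dWa dZa.
rewrite -[LHS]addn0 => /addnI/esym far0.
rewrite !nbhE in xa ya pa qa.
have split_nbh u : adj G a u -> u \in nbh G v \/ u \in thin G v.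
  move=> au; case: (center_cases G v u) => [uv|uN|uW]; last first.
  - right; apply: contraTT au => uZ.
    by rewrite (degin_eq0 far0) // inE uZ.
  - by left.
  - by rewrite uv (far_nadj aW) in au.
have cross u w : u \in nbh G v -> w \in thin G v -> adj G u w = false.
  by move=> uN; rewrite inE => /andP[_ /eqP d0]; rewrite adjC (degin_eq0 d0).
have [xN|xZ] := split_nbh x xa.
  case: (split_nbh p pa) => [pN|/(cross _ _ xN)]; last by rewrite xp.
  case: (split_nbh q qa) => [qN|/(cross _ _ xN)]; last by rewrite xq.
  have : 2 < degin G (nbh G v) a.
    apply/degin_gt2P; exists x, p, q; split=> //; split=> //.
    - exact: adj_neq xp.
    - by rewrite eq_sym (adj_neq xq).
  by rewrite dNa.
case: (split_nbh p pa) => [/cross/(_ xZ)|pZ]; first by rewrite adjC xp.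
case: (split_nbh q qa) => [/cross/(_ xZ)|qZ]; first by rewrite adjC xq.
case: (split_nbh y ya) => [/cross/(_ pZ)|yZ]; first by rewrite yp.
have : 4 <= degin G (thin G v) a.
  apply: leq_trans (sum_ge_seq (s := [:: x; y; p; q]) _ _ _); last first.
  - by rewrite /= xZ yZ pZ qZ.
  - rewrite /= !inE !negb_or xy pq.
    by rewrite (adj_neq xp) (adj_neq xq) (adj_neq yp) (adj_neq yq).
  - by rewrite !big_cons big_nil xa ya pa qa.
by rewrite dZa.
Qed.

Variable v : V.
Hypothesis min5 : forall u, 5 <= degree G u.
Hypothesis dv : degree G v = 5.

Local Notation N := (nbh G v).
Local Notation W := (far G v).
Local Notation A := (thick G v).
Local Notation dN := (degin G N).
Local Notation dW := (degin G W).
Local Notation dA := (degin G A).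
Local Notation Z := (thin G v).
Local Notation S := (\sum_(w in W) (2 * dN w + dW w)).

Lemma far5 w : w \in W -> 5 <= dN w + dW w.
Proof. by move=> wW; rewrite -degree_far. Qed.

(** Charges are doubled so that integers are moved. *)
Lemma doubled_sum : \sum_(w in W) (4 * dN w + 2 * dW w) = 2 * S.
Proof. by rewrite big_distrr; apply: eq_bigr => w _ /=; glia. Qed.

(* Every vertex of A passes 1 along each of its edges to thin vertices; only the
   bad vertices cannot afford it. *)
Lemma five_dense :
  (forall a, ~~ bad G v a) -> 8 <= inner G v -> 8 + 6 * #|W| <= inner G v + S.
Proof.
move=> nobad ge8; suff : 12 * #|W| <= 2 * S by glia.
have subZ : Z \subset W by apply/subsetP => w; rewrite inE => /andP[].
have := degin_exchange G A Z; rewrite -(sum_if_sub _ subZ) -(sum_if_sub _ (thick_sub G v)).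
move=> ex; rewrite -doubled_sum -(leq_add2r (\sum_(w in W) (if w \in A then degin G Z w else 0))).
rewrite {2}ex mulnC -sum_nat_const -!big_split; apply: leq_sum => w wW /=.
have := far5 wW; rewrite thickE wW [w \in Z]inE wW /=.
have := nobad w; rewrite /bad wW /= !negb_and.
have : degin G Z w <= dW w by apply: degin_sub.
case: (eqVneq (dN w) 0) => [d0|].
  by have := link_thick_dA (dN0_link satG wW d0); rewrite d0 /=; glia.
by case: ifP; glia.
Qed.

(** * Minimum degree 5 with few edges inside the neighbourhood *)

Section Sparse.
Hypothesis le7 : inner G v <= 7.
(** The failure of the bound [3 * #|V| - 9], as [2 * #|edges G|] is [10 + inner G v + S] and [#|V|]
    is [6 + #|W|]. *)
Hypothesis small : inner G v + S < 8 + 6 * #|W|.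

Lemma far_links w : w \in W -> link_thick G v w \/ link_mixed G v w.
Proof.
move=> wW; case: (far_link satG wW); [by left | by right |].
by move/(link_innerN le7).
Qed.

Lemma dA_gt0 w : w \in W -> 0 < dA w.
Proof. by move=> /far_links[/link_thick_dA/ltnW|/link_mixed_dA]. Qed.

(* A lower bound for what is left of 4 * dN w + 2 * dW w - 12 once every vertex
   of A has passed 1 along each of its edges into W. *)
Definition cost w : nat :=
  if w \in A then 3 * dN w + dA w - 7 else if dN w == 1 then dA w else dA w - 2.

Lemma cost_sum : \sum_(w in W) cost w + 2 * inner G v <= 12.
Proof.
suff h : 12 * #|W| + \sum_(w in W) cost w <= 2 * S.
  by have := inner_even G v; have := far_even G v; move: h small le7; glia.
rewrite -doubled_sum -(leq_add2r (\sum_(a in A) dW a)) {2}thick_exchange.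
rewrite -(sum_if_sub _ (thick_sub G v)) mulnC -sum_nat_const -!big_split.
apply: leq_sum => w wW /=; rewrite /cost.
have := far5 wW; have := dA_gt0 wW; rewrite thickE wW /=.
case: (eqVneq (dN w) 0) => [d0|].
  by have := link_thick_dA (dN0_link satG wW d0); rewrite d0 /=; glia.
by case: ifP; [|case: (dN w =P 1)]; glia.
Qed.

(** Each of the five vertices of [N] has at least four neighbours besides [v]. *)
Lemma nbh_sum : 20 <= inner G v + \sum_(w in W) dN w.
Proof.
rewrite (degin_exchange G W N) /inner -big_split /=.
have <- : 4 * #|N| = 20 by rewrite card_nbh dv.
by apply: sum_ge_const => x xN; have := min5 x; rewrite (degree_nbh xN); glia.
Qed.

Lemma sparse_flat : (forall x, x \in N -> dN x <= 1) -> False.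
Proof.
move=> le1.
have dA2 w : w \in W -> 1 < dA w.
  move=> /far_links[/link_thick_dA //|/link_mixed_dN[x [xN _]]].
  by rewrite ltnNge le1.
(* This is [2 * cost w - dN w]; comparing [cost_sum] with [nbh_sum] leaves a total slack of at most
   4 and no edge inside [N]. *)
pose slack w := if w \in A then 5 * (dN w - 2) + 2 * (dA w - 2)
  else if dN w == 1 then 2 * dA w - 1 else 2 * (dA w - 2).
have sl_sum : \sum_(w in W) slack w <= 4 /\ inner G v = 0.
  suff : \sum_(w in W) dN w + \sum_(w in W) slack w <= 2 * \sum_(w in W) cost w.
    by have := cost_sum; have := nbh_sum; have := inner_even G v; glia.
  rewrite big_distrr -big_split; apply: leq_sum => w wW; rewrite /slack /cost /=.
  by have := dA2 w wW; rewrite thickE wW /=; case: ifP; [|case: (dN w =P 1)]; glia.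
case: sl_sum => sl4 inner0.
have dx x : x \in N -> dN x = 0.
  by move=> xN; have := inner_ge2 xN; rewrite inner0; glia.
have sl1 w : w \in W -> slack w <= 4.
  move=> wW; apply: leq_trans sl4.
  by have := @sum_ge_seq _ W slack [:: w]; rewrite big_seq1 /= wW => ->.
have sl2 w u : w \in W -> u \in W -> w != u -> slack w + slack u <= 4.
  move=> wW uW wu; apply: leq_trans sl4.
  have := @sum_ge_seq _ W slack [:: w; u].
  by rewrite !big_cons big_nil addn0 /= inE wu wW uW => ->.
have k2 w : w \in W -> dN w <= 2.
  move=> wW; have := sl1 w wW; rewrite /slack thickE wW /=.
  by case: ifP; glia.
have slA w : w \in W -> 2 < dA w -> 2 <= slack w.
  by move=> wW; rewrite /slack; case: ifP; [|case: (dN w =P 1)]; glia.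
have sl_one w : w \in W -> dN w = 1 -> 3 <= slack w.
  by move=> wW d1; have := dA2 w wW; rewrite /slack thickE d1 andbF /=; glia.
have inA w : w \in W -> 0 < dN w -> dN w != 1 -> w \in A.
  by move=> wW; rewrite thickE wW /=; glia.
have adjN w x : x \in N -> adj G x w -> 0 < dN w.
  by move=> xN xw; apply/degin_gt0P; exists x; rewrite // adjC.
(* By [thick_link], [a] has a neighbour [r] with the three neighbours [a], [p], [q] in [A]; such an
   [r] has slack at least 2. *)
have cover a x : a \in A -> x \in N -> ~~ adj G a x ->
    (forall w, w \in W -> adj G x w -> dN w != 1) ->
    exists r, [/\ r \in W, adj G a r & 2 < dA r].
  move=> aA xN nax no1.
  have [r [p [q [rW [pW qW] pq [ar rp rq] [xp xq]]]]] :=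
    thick_link satG (thick_far aA) xN nax (dx x xN) k2.
  exists r; split=> //; apply/degin_gt2P; exists a, p, q.
  split; first by split=> //; apply: inA; rewrite ?(adjN _ x) ?no1.
  split=> //; last by rewrite adjC.
  - by apply: contraNneq nax => ->; rewrite adjC.
  - by apply: contraNneq nax => <-; rewrite adjC.
(* Such a [y] has slack 3. The vertex [r] from [cover] adds 2, or equals [y], whose slack is then at
   least 5. *)
case: (boolP [exists y in W, dN y == 1]) => [/existsP[y /andP[yW /eqP dy]]|no1].
  have /degin_gt0P[a aA ya] := ltnW (dA2 y yW).
  have dNa : dN a <= 2 by apply/k2/thick_far.
  have [x xN /andP[nax nyx]] : exists2 x, x \in N & ~~ adj G a x && ~~ adj G y x.
    apply/exists_inP; apply: contraT; rewrite negb_exists_in => /forall_inP h.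
    have : 1 * #|N| <= \sum_(x in N) (adj G a x + adj G y x).
      by apply: sum_ge_const => x /h; case: adj; case: adj.
    by rewrite big_split /= card_nbh dv -/(dN a) -/(dN y) dy; glia.
  have [|r [rW ar r3]] := cover a x aA xN nax.
    move=> w wW xw; apply/eqP => dw; have := sl_one w wW dw.
    have wy : w != y by apply: contraNneq nyx => <-; rewrite adjC.
    by have := sl2 w y wW yW wy; have := sl_one y yW dy; glia.
  case: (eqVneq r y) => [ry|ry].
    have := sl1 y yW; rewrite /slack thickE dy andbF /= -ry; glia.
  by have := sl2 r y rW yW ry; have := sl_one y yW dy; have := slA r rW r3; glia.
have n1 w : w \in W -> dN w != 1.
  by move=> wW; apply: contraNN no1 => d1; apply/exists_inP; exists w.
have le20 : 20 <= 2 * #|A|.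
  apply: leq_trans (_ : \sum_(w in W) dN w <= _); first by have := nbh_sum; rewrite inner0.
  rewrite -sum1_card big_distrr /= -(sum_if_sub _ (thick_sub G v)).
  apply: leq_sum => w wW; have := k2 w wW; have := n1 w wW; rewrite thickE wW /=.
  by case: ifP; glia.
have : 2 * #|A| <= 3 * 4; last by glia.
apply: leq_trans (_ : 3 * \sum_(r in W) slack r <= _); last by glia.
(* Every vertex of [A] has a neighbour [r] with [2 < dA r], and then [2 * dA r <= 3 * slack r]. *)
have : #|A| <= \sum_(r in W) (2 < dA r) * dA r.
  rewrite -sum1_card; under [leqRHS]eq_bigr do rewrite /degin big_distrr.
  rewrite [leqRHS]exchange_big; apply: leq_sum => a aA /=.
  have [x xN nax] : exists2 x, x \in N & ~~ adj G a x.
    apply/exists_inP; apply: contraT; rewrite negb_exists_in => /forall_inP h.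
    have : 1 * #|N| <= dN a by apply: sum_ge_const => x /h; case: adj.
    by have := k2 a (thick_far aA); rewrite card_nbh dv; glia.
  have [|r [rW ar r3]] := cover a x aA xN nax; first by move=> w wW _; apply: n1.
  by rewrite (bigD1 r) //= r3 adjC ar.
move=> le; apply: leq_trans (leq_mul (leqnn 2) le) _.
rewrite !big_distrr; apply: leq_sum => r rW /=.
by case: ltnP => //= r3; rewrite /slack; case: ifP; [|case: (dN r =P 1)]; glia.
Qed.

Lemma nbh_far_deg x : x \in N -> 4 <= dN x + dW x.
Proof. by move=> xN; have := min5 x; rewrite (degree_nbh xN). Qed.

(** [N] induces the path [c1], [b], [c2] and two isolated vertices, which form [X]. A second
    discharging leaves every vertex of [W] at most two neighbours in [A], and linking a neighbour of
    [c1] to a vertex of [X] contradicts this. *)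
Lemma sparse_path b : inner G v <= 5 -> b \in N -> 1 < dN b -> False.
Proof.
move=> le5 bN /[dup] kb /degin_gt1P[c1 [c2 [c1N c2N c12 bc1 bc2]]].
have bc1n := adj_neq bc1; have bc2n := adj_neq bc2.
have dge1 x : x \in N -> adj G b x -> 0 < dN x.
  by move=> xN bx; apply/degin_gt0P; exists b; rewrite // adjC.
pose X := N :\: [set b; c1; c2].
have uN : [set b; c1; c2] \subset N by rewrite !subUset !sub1set bN c1N c2N.
have cbc : #|[set b; c1; c2]| = 3.
  by rewrite -setUA cardsU1 cards2 !inE negb_or bc1n bc2n c12.
have cardX : #|X| = 2 by rewrite cardsD (setIidPr uN) card_nbh dv cbc.
have sum3 (f : V -> nat) : \sum_(y in [set b; c1; c2]) f y = f b + f c1 + f c2.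
  rewrite -setUA big_setU1 ?inE ?negb_or ?bc1n ?bc2n //= big_setU1 ?inE //= big_set1; glia.
have inner4 : inner G v = 4 /\ (forall x, x \in X -> dN x = 0).
  have le4 : inner G v <= 4 by have := inner_even G v; glia.
  have sumb : inner G v = dN b + dN c1 + dN c2 + \sum_(x in X) dN x.
    rewrite /inner (big_setID [set b; c1; c2]) /= (setIidPr uN); congr (_ + _).
    exact: sum3.
  have := dge1 c1 c1N bc1; have := dge1 c2 c2N bc2; split; first by glia.
  move=> x xX; have : dN x <= \sum_(x in X) dN x.
    by have := @sum_ge_seq _ X dN [:: x]; rewrite big_seq1 /= xX => ->.
  glia.
case: inner4 => inner4 X0.
have XN x : x \in X -> x \in N by rewrite inE => /andP[].
have dNX w : dN w = adj G w b + adj G w c1 + adj G w c2 + degin G X w.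
  by rewrite (degin_split _ N [set b; c1; c2]) (setIidPr uN) /degin sum3.
have in3 x : x \in N -> 0 < dN x -> [\/ x = b, x = c1 | x = c2].
  move=> xN; case xX: (x \in X); first by rewrite X0.
  move: xX; rewrite inE xN andbT !inE -orbA => /negbFE/or3P[]/eqP -> _.
  - by constructor 1.
  - by constructor 2.
  - by constructor 3.
have only_b x : x \in N -> 1 < dN x -> x = b.
  move=> xN kx; apply: contraTeq kx => xb.
  have [dx0|dx1] := posnP (dN x); first by rewrite dx0.
  have sum2 : dN b + dN x + dN (if x == c1 then c2 else c1) <= 4.
    rewrite -inner4; have := @sum_ge_seq _ N dN [:: b; x; if x == c1 then c2 else c1].
    rewrite !big_cons big_nil addn0 addnA => -> //=.
      rewrite !inE !negb_or eq_sym xb.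
      by case: (eqVneq x c1) => [->|xc1]; rewrite ?bc1n ?bc2n ?c12 ?xc1.
    by rewrite bN xN; case: ifP; rewrite ?c1N ?c2N.
  have : 0 < dN (if x == c1 then c2 else c1) by case: ifP => _; apply: dge1.
  glia.
pose A' := [set a in A | adj G a c1 && adj G a c2].
pose Q := [set a in A | (dN a == 2) && (dA a == 1)].
have subA' : A' \subset A by apply/subsetP => a; rewrite inE => /andP[].
have subQ : Q \subset A by apply/subsetP => a; rewrite inE => /andP[].
have mixed w : link_mixed G v w -> adj G w b /\ 0 < degin G A' w.
  move=> [x [a [p [q [pq [xN aA pN qN] /andP[wx wa] /and4P[xp xq ap aq]]]]]].
  have xb : x = b by apply: only_b => //; apply/degin_gt1P; exists p, q.
  rewrite -xb; split=> //; apply/degin_gt0P; exists a; rewrite // inE aA /=.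
  rewrite {}xb in xp xq wx.
  have pb := adj_neq xp; have qb := adj_neq xq.
  case: (in3 p pN (dge1 p pN xp)) => [pb'|pc|pc]; first by rewrite pb' eqxx in pb.
    case: (in3 q qN (dge1 q qN xq)) => [qb'|qc|qc]; first by rewrite qb' eqxx in qb.
      by rewrite pc qc eqxx in pq.
    by rewrite -pc -qc ap aq.
  case: (in3 q qN (dge1 q qN xq)) => [qb'|qc|qc]; first by rewrite qb' eqxx in qb.
    by rewrite -pc -qc ap aq.
  by rewrite pc qc eqxx in pq.
pose extra w : nat := [|| 2 < dN w, dN w == 1 | 2 < dA w].
(* Each vertex of [A'] gives 1 to each neighbour in [Q]; a vertex of [Q] has a mixed link, hence a
   neighbour in [A']. [extra] marks the configurations to be excluded. *)
have local w : w \in W ->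
    degin G X w + (if w \in A' then degin G Q w else 0) + extra w <=
    2 * cost w + (if w \in Q then degin G A' w else 0).
  move=> wW; have dw := dNX w; have links := far_links wW.
  have := dA_gt0 wW; have leQ : degin G Q w <= dA w by apply: degin_sub.
  have [d0|dpos] := posnP (dN w).
    have := link_thick_dA (dN0_link satG wW d0).
    rewrite /cost /extra [w \in A']inE [w \in Q]inE thickE wW d0 /=.
    by move: dw; rewrite d0; case: ltnP; glia.
  have [d1|dn1] := eqVneq (dN w) 1.
    rewrite /cost /extra [w \in A']inE [w \in Q]inE thickE wW d1 /=.
    by move: dw; rewrite d1; glia.
  have wA : w \in A by rewrite thickE wW; glia.
  rewrite /cost /extra [w \in A']inE [w \in Q]inE wA (negbTE dn1) /=.
  case: (ltnP 2 (dN w)) => [k3|k2] /=.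
    have -> : (dN w == 2) = false by glia.
    by rewrite /=; case: ifP; glia.
  have k2' : dN w = 2 by glia.
  rewrite k2' eqxx /=.
  case: links => [/link_thick_dA dA2|/mixed[wb gtA']].
    have -> : (dA w == 1) = false by glia.
    by move: dw; rewrite k2'; case: (adj G w c1); case: (adj G w c2) => /=; case: ltnP; glia.
  by move: dw; rewrite k2' wb; case: (adj G w c1); case: (adj G w c2) => /=;
    case: (eqVneq (dA w) 1) => [->|]; case: ltnP => //=; glia.
(* At least eight edges join [X] to [W], and twice the total cost is at most [2 * (12 - 8)]. *)
have ex0 : \sum_(w in W) extra w = 0.
  have sumX : 8 <= \sum_(w in W) degin G X w.
    rewrite degin_exchange; apply: leq_trans (_ : 4 * #|X| <= _); first by rewrite cardX.
    apply: sum_ge_const => x xX.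
    by have := nbh_far_deg (XN x xX); rewrite X0.
  have : \sum_(w in W) (degin G X w + (if w \in A' then degin G Q w else 0) + extra w) <=
         \sum_(w in W) (cost w + cost w + (if w \in Q then degin G A' w else 0)).
    by apply: leq_sum => w wW; rewrite addnn -mul2n; apply: local.
  rewrite !big_split /= sum_if_sub ?(subset_trans subA') ?thick_sub //.
  rewrite sum_if_sub ?(subset_trans subQ) ?thick_sub // (degin_exchange G A' Q).
  by have := cost_sum; rewrite inner4; glia.
have no_extra w : w \in W -> [/\ dN w <= 2, dN w != 1 & dA w <= 2].
  move=> wW; have : extra w <= 0.
    rewrite -ex0; have := @sum_ge_seq _ W extra [:: w].
    by rewrite big_seq1 /= wW => ->.
  rewrite /extra leqn0 eqb0 !negb_or -!leqNgt => /and3P[-> -> ->] //.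
have [a aW c1a] : exists2 a, a \in W & adj G c1 a.
  apply/degin_gt0P; have := nbh_far_deg c1N.
  by have := inner_ge2 c1N; rewrite inner4; glia.
have [x xX nax] : exists2 x, x \in X & ~~ adj G a x.
  apply/exists_inP; apply: contraT; rewrite negb_exists_in => /forall_inP h.
  have : 1 * #|X| <= degin G X a by apply: sum_ge_const => x /h; case: adj.
  have [k2 _ _] := no_extra a aW; have := dNX a; rewrite cardX [adj G a c1]adjC c1a; glia.
have [r [p [q [rW [pW qW] pq [ar rp rq] [xp xq]]]]] :=
  thick_link satG aW (XN x xX) nax (X0 x xX) (fun w wW => let: And3 h _ _ := no_extra w wW in h).
have inA w y : y \in N -> w \in W -> adj G y w -> w \in A.
  move=> yN wW yw; have [_ n1 _] := no_extra w wW.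
  rewrite thickE wW /= ltn_neqAle eq_sym n1; apply/degin_gt0P.
  by exists y; rewrite // adjC.
have [_ _] := no_extra r rW; rewrite leqNgt => /negP; apply.
apply/degin_gt2P; exists a, p, q; split.
  by rewrite (inA a c1) // (inA p x) ?(inA q x) ?XN.
split=> //; last by rewrite adjC.
- by apply: contraNneq nax => ->; rewrite adjC.
- by apply: contraNneq nax => <-; rewrite adjC.
Qed.

(** All costs vanish, so thick vertices come in adjacent pairs [a], [a'] with mixed links through
    each other. This gives every vertex of [N] a neighbour in [N] and two of them at least two, so
    [inner G v] is at least 7. *)
Lemma sparse_tight : 6 <= inner G v -> False.
Proof.
move=> ge6; have inner6 : inner G v = 6 by have := inner_even G v; glia.
have cost0 w : w \in W -> cost w = 0.
  move=> wW; have : cost w <= 0; last by glia.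
  have := cost_sum; have := @sum_ge_seq _ W cost [:: w].
  by rewrite big_seq1 /= wW => /(_ isT isT); glia.
have tight w x : w \in W -> x \in N -> adj G x w ->
    [/\ w \in A, dN w = 2 & dA w <= 1].
  move=> wW xN xw; have := cost0 w wW; have := dA_gt0 wW.
  have : 0 < dN w by apply/degin_gt0P; exists x; rewrite // adjC.
  rewrite /cost thickE wW /=; case: (ltnP 1 (dN w)) => [k2|le1]; last first.
    by case: (dN w =P 1); glia.
  by move=> _ d0 c0; split=> //; glia.
have tightA w : w \in A -> [/\ dN w = 2, dA w <= 1 & link_mixed G v w].
  move=> wA; have wW := thick_far wA.
  have /ltnW/degin_gt0P[x xN wx] : 1 < dN w by move: wA; rewrite thickE => /andP[].
  have [_ d2 d1] := tight w x wW xN (etrans (adjC G x w) wx).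
  by split=> //; case: (far_links wW) => // /link_thick_dA; rewrite ltnNge d1.
have mate o : o \in N -> exists x y, [/\ x \in N /\ y \in N, 1 < dN x, 1 < dN y, x != y & adj G o y].
  move=> oN.
  have /degin_gt0P[a aW oa] : 0 < dW o.
    by have := nbh_far_deg oN; have := inner_ge2 oN; rewrite inner6; glia.
  have [aA ka da] := tight a o aW oN oa.
  have [_ _ [x [a' [p [q [pq [xN a'A pN qN] /andP[ax aa'] /and4P[xp xq a'p a'q]]]]]]] := tightA a aA.
  have [_ da' [y [a2 [s [t [st [yN a2A sN tN] /andP[a'y a'a2] /and4P[ys yt a2s a2t]]]]]]] :=
    tightA a' a'A.
  have a2a : a2 = a by apply: (degin_le1 da' a2A aA a'a2); rewrite adjC.
  rewrite {}a2a in a2s a2t a2A.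
  have inst z : z \in N -> adj G a z -> adj G z y.
    move=> zN az; have := @degin_le2 _ G N a s t z; rewrite ka leqnn sN tN zN a2s a2t az.
    by case=> // ->; rewrite adjC.
  exists x, y; split=> //.
  - by apply/degin_gt1P; exists p, q.
  - by apply/degin_gt1P; exists s, t.
  - exact/adj_neq/inst.
  - by apply: inst; rewrite // adjC.
have dpos o : o \in N -> 0 < dN o.
  by move=> oN; have [x [y [[_ yN] _ _ _ oy]]] := mate o oN; apply/degin_gt0P; exists y.
have [o oN] : exists o, o \in N by apply/card_gt0P; rewrite card_nbh dv.
have [x [y [[xN yN] dx dy xy _]]] := mate o oN.
have : 5 + 2 <= inner G v; last by rewrite inner6.
rewrite /inner (eq_bigr (fun z => 1 + (dN z - 1))) => [|z zN]; last by have := dpos z zN; glia.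
rewrite big_split /= sum1_card card_nbh dv leq_add2l.
have := @sum_ge_seq _ N (fun z => dN z - 1) [:: x; y].
rewrite !big_cons big_nil /= inE xy xN yN => /(_ isT isT); glia.
Qed.

Lemma sparse_contra : False.
Proof.
case: (leqP 6 (inner G v)) => [/sparse_tight //|le5].
case: (boolP [exists b in N, 1 < dN b]) => [/exists_inP[b bN kb]|h].
  exact: (@sparse_path b).
apply: sparse_flat => x xN; rewrite leqNgt; apply: contraNN h => kx.
by apply/exists_inP; exists x.
Qed.

End Sparse.
End Five.

Lemma min5_far (V : finType) (G : sgraph V) (v : V) :
  saturated (Kbip 3 3) G -> (forall u, 5 <= degree G u) -> degree G v = 5 ->
  (forall a, ~~ bad G v a) ->
  8 + 6 * #|far G v| <= inner G v + \sum_(w in far G v) (2 * degin G (nbh G v) w + degin G (far G v) w).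
Proof.
move=> satG min5 dv nobad; case: (leqP 8 (inner G v)) => [|le7]; first exact: five_dense.
by rewrite leqNgt; apply/negP; apply: sparse_contra.
Qed.

Lemma min5_edges (V : finType) (G : sgraph V) (v : V) :
  saturated (Kbip 3 3) G -> (forall u, 5 <= degree G u) -> degree G v = 5 ->
  3 * #|V| - 9 <= #|edges G|.
Proof.
move=> satG min5 dv.
have main u : degree G u = 5 -> (forall a, ~~ bad G u a) -> 3 * #|V| - 9 <= #|edges G|.
  move=> du nobad; have := min5_far satG min5 du nobad; have := edges_center G u.
  rewrite (card_center G u) card_nbh du; glia.
case: (boolP [exists a, bad G v a]) => [/existsP[a bad_a]|].
  apply: (main a); last by move=> b; apply: bad_center bad_a.
  by have /and4P[aW /eqP dNa /eqP dWa _] := bad_a; rewrite (degree_far aW) dNa dWa.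
by rewrite negb_exists => /forallP; apply: main.
Qed.

(** * Minimum degree 2 *)

Section Parts.
Variables (V : finType) (G : sgraph V) (load : V -> nat).
Implicit Types (S T U B D : {set V}).

(* Twice the number of edges inside S plus twice the load of S, so that a set
   with weight S < 2 * #|S| contains an acyclic unloaded component. *)
Definition weight S : nat := \sum_(s in S) (degin G S s + 2 * load s).

(** [T] induces a forest. *)
Definition sparse T : Prop :=
  forall U, U \subset T -> U != set0 -> exists2 u, u \in U & degin G U u <= 1.

Lemma weightU S T : [disjoint S & T] ->
  weight (S :|: T) = weight S + weight T + 2 * \sum_(t in T) degin G S t.
Proof.
move=> dST; rewrite /weight (eq_bigl [predU S & T]) => [|s]; last by rewrite !inE.
rewrite bigU //=.
rewrite [X in X + _](eq_bigr (fun s => degin G S s + 2 * load s + degin G T s)) => [|s _]; last first.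
  by rewrite deginU // addnAC.
rewrite [X in _ + X](eq_bigr (fun s => degin G T s + 2 * load s + degin G S s)) => [|s _]; last first.
  by rewrite deginU //; lia.
by rewrite !big_split /= (degin_exchange G S T); lia.
Qed.

(** Take [S] maximal with deficit at most [k]. Every nonempty [U] outside [S] has too little weight
    to be added: singletons show that nothing outside is loaded or adjacent to [S], larger sets that
    the remainder is a forest. *)
Lemma grow_part B S0 k : S0 \subset B -> 2 * #|S0| <= weight S0 + k ->
  exists S, [/\ S0 \subset S /\ S \subset B, 2 * #|S| <= weight S + k,
    forall t, t \in B :\: S -> degin G S t = 0 /\ load t = 0 &
    sparse (B :\: S)].
Proof.
move=> S0B S0k; pose P S := (S \subset B) && (2 * #|S| <= weight S + k).
have [S /maxsetP[/andP[SB Sk] maxS] S0S] := @maxset_exists _ P S0 (introT andP (conj S0B S0k)).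
have noU U : U \subset B :\: S -> U != set0 ->
    weight U + 2 * \sum_(t in U) degin G S t < 2 * #|U|.
  move=> UBS U0; rewrite ltnNge; apply/negP => le.
  have dSU : [disjoint S & U].
    by rewrite disjoint_sym; move: UBS; rewrite subsetD => /andP[].
  have : S :|: U = S.
    apply: maxS; last exact: subsetUl.
    rewrite /P subUset SB (subset_trans UBS) ?subsetDl //= weightU //.
    by rewrite cardsU disjoint_setI0 // cards0; lia.
  move=> /setUidPl /(subset_trans _) US; case/set0Pn: U0 => u uU.
  have uS : u \in S by apply: (subsetP (US U (subxx U))).
  by rewrite (disjointFr dSU uS) in uU.
exists S; split=> // [t tBS|U UBS U0].
  have := noU [set t]; rewrite sub1set tBS => /(_ isT).
  rewrite -card_gt0 cards1 /weight !big_set1 => /(_ isT); lia.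
apply/exists_inP; apply: contraT; rewrite negb_exists_in => /forall_inP h.
have := noU U UBS U0; have : 2 * #|U| <= weight U; last by lia.
by apply: sum_ge_const => u /h; rewrite -ltnNge; lia.
Qed.

(** A nonempty union of unloaded tree components of [D]. *)
Definition part D T : Prop :=
  [/\ T \subset D, T != set0, sparse T,
      forall t, t \in T -> load t = 0 &
      forall t u, t \in T -> u \in D -> adj G t u -> u \in T].

Lemma sparse_sub T U : U \subset T -> sparse T -> sparse U.
Proof. by move=> UT spT U' U'U; apply: spT; apply: subset_trans UT. Qed.

(** First grow the empty set with deficit 0, then a single vertex of the remainder with deficit 2,
    twice. Either [D] is exhausted with total deficit at most 4, or the last remainder is a third
    part. *)
Lemma three_parts D : 2 * #|D| <= weight D + 4 \/
  exists T1 T2 T3, [/\ part D T1, part D T2 & part D T3] /\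
    [/\ [disjoint T1 & T2], [disjoint T2 & T3] & [disjoint T1 & T3]].
Proof.
have cardD' S B : S \subset B -> #|B| = #|S| + #|B :\: S|.
  by move=> SB; rewrite -(cardsID S B) (setIidPr SB).
have wD S B : S \subset B -> weight S + weight (B :\: S) <= weight B.
  move=> SB; rewrite -{2}(setID B S) (setIidPr SB) weightU ?leq_addr //.
  by rewrite -setI_eq0; apply/eqP/setP => z; rewrite !inE; case: (z \in S); rewrite ?andbF.
have [||S0 [[_ S0D] S0k S0T spT]] := @grow_part D set0 0.
- exact: sub0set.
- by rewrite cards0.
have cD := cardD' _ _ S0D; have wD0 := wD _ _ S0D.
set T0 := D :\: S0 in S0T spT cD wD0.
case: (eqVneq T0 set0) => [T00|/set0Pn[t tT]].
  by left; move: cD wD0; rewrite T00 cards0; lia.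
have [||S1 [[tS1 S1T] S1k S1R spR]] := @grow_part T0 [set t] 2; rewrite ?sub1set //.
  by rewrite cards1; lia.
have cT := cardD' _ _ S1T; have wT := wD _ _ S1T.
set R := T0 :\: S1 in S1R spR cT wT.
case: (eqVneq R set0) => [R0|/set0Pn[r rR]].
  by left; move: cT wT; rewrite R0 cards0; lia.
have [||S2 [[rS2 S2R] S2k S2Q spQ]] := @grow_part R [set r] 2; rewrite ?sub1set //.
  by rewrite cards1; lia.
have cR := cardD' _ _ S2R; have wR := wD _ _ S2R.
set Q := R :\: S2 in S2Q spQ cR wR.
case: (eqVneq Q set0) => [Q0|Qn0].
  by left; move: cR wR; rewrite Q0 cards0; lia.
right; exists S1, S2, Q.
have T0D : T0 \subset D by apply: subsetDl.
have RT : R \subset T0 by apply: subsetDl.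
have QR : Q \subset R by apply: subsetDl.
have load0 u : u \in T0 -> load u = 0 by move=> /S0T[].
have nadj S u w : degin G S u = 0 -> w \in S -> adj G w u = false.
  by move=> d0 wS; rewrite adjC (degin_eq0 d0).
have T0cl u w : u \in T0 -> w \in D -> adj G u w -> w \in T0.
  move=> uT wD' uw; rewrite inE wD' andbT; apply/negP => wS.
  have [d0 _] := S0T u uT.
  by rewrite (degin_eq0 d0 wS) in uw.
have S1cl u w : u \in T0 -> w \in T0 -> adj G u w -> (u \in S1) = (w \in S1).
  move=> uT wT' uw; apply/idP/idP => inS; apply: contraLR uw => nS.
    have [|d0 _] := S1R w; first by rewrite inE nS.
    by rewrite adjC (degin_eq0 d0).
  have [|d0 _] := S1R u; first by rewrite inE nS.
  by rewrite (degin_eq0 d0).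
have S2cl u w : u \in R -> w \in R -> adj G u w -> (u \in S2) = (w \in S2).
  move=> uT wT' uw; apply/idP/idP => inS; apply: contraLR uw => nS.
    have [|d0 _] := S2Q w; first by rewrite inE nS.
    by rewrite adjC (degin_eq0 d0).
  have [|d0 _] := S2Q u; first by rewrite inE nS.
  by rewrite (degin_eq0 d0).
have Rcl u w : u \in R -> w \in D -> adj G u w -> w \in R.
  move=> /[dup] uR; rewrite inE => /andP[nS1 uT] wD' uw; have wT' := T0cl u w uT wD' uw.
  by rewrite inE wT' -(S1cl u w uT wT' uw) nS1.
split; split.
- split=> //.
  + exact: subset_trans T0D.
  + by apply/set0Pn; exists t; rewrite -sub1set.
  + exact: sparse_sub spT.
  + by move=> u /(subsetP S1T)/load0.
  + move=> u w uS wD' uw; have uT := subsetP S1T u uS.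
    by rewrite -(S1cl u w uT (T0cl u w uT wD' uw) uw).
- split=> //.
  + exact: subset_trans S2R (subset_trans RT T0D).
  + by apply/set0Pn; exists r; rewrite -sub1set.
  + exact: sparse_sub spR.
  + by move=> u /(subsetP S2R)/(subsetP RT)/load0.
  + move=> u w uS wD' uw; have uR := subsetP S2R u uS.
    by rewrite -(S2cl u w uR (Rcl u w uR wD' uw) uw).
- split=> //.
  + exact: subset_trans QR (subset_trans RT T0D).
  + by move=> u /(subsetP QR)/(subsetP RT)/load0.
  + move=> u w /[dup] uQ; rewrite inE => /andP[nS uR] wD' uw.
    have wR' := Rcl u w uR wD' uw.
    by rewrite inE wR' -(S2cl u w uR wR' uw) nS.
- by rewrite disjoint_sym; move: S2R; rewrite subsetD => /andP[].
- by rewrite disjoint_sym; have : Q \subset R :\: S2 by []; rewrite subsetD => /andP[].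
- by rewrite disjoint_sym; have := QR; rewrite subsetD => /andP[].
Qed.

End Parts.

(** * The core and the rest around a vertex of degree 2 *)

Section Two.
Variables (V : finType) (G : sgraph V) (v x y : V).
Hypothesis satG : saturated (Kbip 3 3) G.
Hypothesis nbv : forall w, adj G v w = (w == x) || (w == y).
Hypothesis nxy : x != y.
Implicit Types (S T U : {set V}) (a b c d w t u : V).

Definition core : {set V} := [set w | [&& w != v, adj G x w & adj G y w]].
Definition rest : {set V} := [set w | [&& w != v, w != x, w != y & w \notin core]].
Definition load2 w : nat := adj G w x + adj G w y.
Definition coreN w : {set V} := [set c in core | adj G w c].

Local Notation C := core.
Local Notation D := rest.
Local Notation P := coreN.

Lemma vx : adj G v x. Proof. by rewrite nbv eqxx. Qed.
Lemma vy : adj G v y. Proof. by rewrite nbv eqxx orbT. Qed.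

Lemma coreE c : (c \in C) = [&& c != v, adj G x c & adj G y c].
Proof. by rewrite inE. Qed.

Lemma core_out c : c \in C -> [/\ c != v, c != x & c != y].
Proof.
by rewrite coreE => /and3P[cv xc yc]; rewrite cv eq_sym (adj_neq xc) eq_sym (adj_neq yc).
Qed.

Lemma rest_out d : d \in D -> [/\ d != v, d != x, d != y & d \notin C].
Proof. by rewrite inE => /and4P[]. Qed.

Lemma two_cases w : [\/ w \in [:: v; x; y], w \in C | w \in D].
Proof.
rewrite [w \in D]inE !in_cons in_nil orbF.
case: (w == v) => /=; first by constructor 1.
case: (w == x) => /=; first by constructor 1.
case: (w == y) => /=; first by constructor 1.
by case: (w \in C); [constructor 2 | constructor 3].
Qed.

Lemma sum_two (f : V -> nat) :
  \sum_w f w = f v + f x + f y + \sum_(c in C) f c + \sum_(d in D) f d.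
Proof.
rewrite (bigD1 v) //= (bigD1 x) /=; last by rewrite eq_sym (adj_neq vx).
rewrite (bigD1 y) /=; last by rewrite eq_sym (adj_neq vy) eq_sym nxy.
rewrite (bigID (mem C)) /= -!addnA; do 4 congr (_ + _).
  apply: eq_bigl => w; case wC: (w \in C); last by rewrite andbF.
  by have [-> -> ->] := core_out wC.
by apply: eq_bigl => w; rewrite [w \in D]inE -!andbA.
Qed.

Lemma coreN_card w : #|P w| = degin G C w.
Proof. by rewrite degin_card. Qed.

(* v is linked to w only through {x, y}, which puts two neighbours of w in the
   core; three of them would make a K_{3,3} on {x, y, w}. *)
Lemma degin_core w : w \notin [:: v; x; y] -> degin G C w = 2.
Proof.
rewrite !in_cons in_nil orbF !negb_or => /and3P[wv wx wy].
have nvw : ~~ adj G v w by rewrite nbv negb_or wx wy.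
apply/eqP; rewrite eqn_leq; apply/andP; split.
  rewrite leqNgt; apply/negP => /degin_gt2P[c1 [c2 [c3 [[c1C c2C c3C] [c12 c23 c31 w1 [w2 w3]]]]]].
  case: satG => + _; apply; apply: (@contains_K33 _ G x y w c1 c2 c3).
  - by rewrite /= !in_cons !in_nil !orbF !negb_or nxy ![_ == w]eq_sym wx wy.
  - by rewrite /= !in_cons !in_nil !orbF !negb_or c12 c23 eq_sym c31.
  - move: c1C c2C c3C; rewrite !coreE /= w1 w2 w3.
    by move=> /and3P[_ -> ->] /and3P[_ -> ->] /and3P[_ -> ->].
have vw : v != w by rewrite eq_sym.
have [a1 [a2 [b1 [b2 [a12 b12 /andP[wa1 wa2] /andP[vb1 vb2] /and4P[h1 h2 h3 h4]]]]]] :=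
  saturated_link satG vw nvw.
have inC a : adj G w a -> adj G a b1 -> adj G a b2 -> a \in C.
  move=> wa ab1 ab2; rewrite coreE; apply/and3P; split.
  - by apply: contraNneq nvw => <-; rewrite adjC.
  - move: vb1 vb2; rewrite !nbv !(adjC G _ a) => /orP[]/eqP e1 /orP[]/eqP e2;
    by rewrite -?e1 -?e2 // e1 e2 eqxx in b12 *.
  - move: vb1 vb2; rewrite !nbv !(adjC G _ a) => /orP[]/eqP e1 /orP[]/eqP e2;
    by rewrite -?e1 -?e2 // e1 e2 eqxx in b12 *.
by apply/degin_gt1P; exists a1, a2; rewrite !inC.
Qed.

Lemma degin_core_in c : c \in C -> degin G C c = 2.
Proof.
by move=> /core_out[cv cx cy]; rewrite degin_core // !inE !negb_or cv cx cy.
Qed.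

Lemma degin_core_rest d : d \in D -> degin G C d = 2.
Proof.
by move=> /rest_out[dv dx dy _]; rewrite degin_core // !inE !negb_or dv dx dy.
Qed.

(** There are 2 edges at [v], possibly [xy], [2 * #|C|] from [C] to [x] and [y], [#|C|] inside the
    2-regular core, [2 * #|D|] from [D] to [C], and those of the last sum. *)
Lemma edges_two :
  2 * #|edges G| = 4 + 2 * adj G x y + 6 * #|C| + 4 * #|D| +
    \sum_(d in D) (degin G D d + 2 * load2 d).
Proof.
have degE u : degree G u = adj G u v + adj G u x + adj G u y + degin G C u + degin G D u.
  by rewrite degreeE /degin -sum_two; apply: eq_bigl => w; rewrite inE.
have all1 u : (forall c, c \in C -> adj G u c) -> degin G C u = #|C|.
  by move=> h; rewrite -sum1_card; apply: eq_bigr => c /h ->.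
have none S u : (forall s, s \in S -> ~~ adj G u s) -> degin G S u = 0.
  by move=> h; apply: big1 => s /h /negbTE ->.
rewrite -handshake sum_two !degE !(adj_irr G) vx vy.
rewrite ![adj G _ v]adjC ![adj G v _]nbv !eqxx (eq_sym y x) (negbTE nxy) /=.
rewrite (none C v) => [|c /core_out[_ cx cy]]; last by rewrite nbv negb_or cx cy.
rewrite (none D v) => [|d /rest_out[_ dx dy _]]; last by rewrite nbv negb_or dx dy.
rewrite (all1 x) => [|c]; last by rewrite coreE => /and3P[].
rewrite (all1 y) => [|c]; last by rewrite coreE => /and3P[].
have -> : \sum_(c in C) degree G c = \sum_(c in C) (4 + degin G D c).
  apply: eq_bigr => c cC; rewrite degE degin_core_in // adjC nbv.
  have [_ cx cy] := core_out cC; rewrite (negbTE cx) (negbTE cy).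
  by move: cC; rewrite coreE !(adjC G c) => /and3P[_ -> ->].
have -> : \sum_(d in D) degree G d = \sum_(d in D) (2 + adj G d x + adj G d y + degin G D d).
  apply: eq_bigr => d dD; rewrite degE degin_core_rest // adjC nbv.
  have [_ dx dy _] := rest_out dD; rewrite (negbTE dx) (negbTE dy) /=; lia.
have -> : \sum_(d in D) (degin G D d + 2 * load2 d) =
          \sum_(d in D) (degin G D d + (adj G d x + adj G d y) + (adj G d x + adj G d y)).
  by apply: eq_bigr => d _; rewrite /load2; lia.
rewrite !big_split /= !sum_nat_const (degin_exchange G C D).
have -> : \sum_(d in D) degin G C d = 2 * #|D|.
  by rewrite (eq_bigr (fun=> 2)) => [|d]; [rewrite sum_nat_const mulnC | apply: degin_core_rest].
have -> : degin G D x = \sum_(d in D) adj G d x by apply: eq_bigr => d _; rewrite adjC.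
have -> : degin G D y = \sum_(d in D) adj G d y by apply: eq_bigr => d _; rewrite adjC.
rewrite (adjC G y x); lia.
Qed.

Lemma card_two : #|V| = 3 + #|C| + #|D|.
Proof.
have -> : #|V| = \sum_(w : V) 1 by rewrite sum1_card.
by rewrite (sum_two (fun=> 1)) !sum1_card.
Qed.

Lemma coreN_eq w a b : w \notin [:: v; x; y] -> a \in C -> b \in C -> a != b ->
  adj G w a -> adj G w b -> P w = [set a; b].
Proof.
move=> wn aC bC ab wa wb; apply/esym/eqP; rewrite eqEcard cards2 ab coreN_card.
by rewrite degin_core // leqnn andbT subUset !sub1set ![_ \in P w]inE aC bC wa wb.
Qed.

Lemma core_notin c : c \in C -> c \notin [:: v; x; y].
Proof. by move=> /core_out[cv cx cy]; rewrite !inE !negb_or cv cx cy. Qed.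

Lemma rest_notin d : d \in D -> d \notin [:: v; x; y].
Proof. by move=> /rest_out[dv dx dy _]; rewrite !inE !negb_or dv dx dy. Qed.

Lemma coreN_self c : c \in P c = false.
Proof. by rewrite inE (adj_irr G) andbF. Qed.

(* P w is the pair of neighbours of w in the core. When d and d' lie in different
   parts, the two pairs linking them are P d and P d' (then each covers the
   other), or one of them meets the part T of d (then beta T d d') or that of
   d' (then beta T' d' d); see part_link. *)
Definition strong d d' := [exists b in P d, P b == P d'].
Definition covers d d' := [forall b in P d, P b == P d'].
Definition hits T d d' := [exists t in T, adj G d t && (P t == P d')].
Definition hits_twice T d d' := 1 < degin G [set t in T | P t == P d'] d.
Definition beta T d d' := hits T d d' && (strong d d' || hits_twice T d d').

Notation part := (part G load2 D).

Lemma part_rest T d : part T -> d \in T -> d \in D.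
Proof. by case=> TD _ _ _ _; apply: (subsetP TD). Qed.

Lemma part_nbr T d u : part T -> d \in T -> adj G d u -> (u \in C) || (u \in T).
Proof.
move=> partT dT du; have dD := part_rest partT dT.
have [_ _ _ load0 closed] := partT.
have [dv dx dy _] := rest_out dD; have := load0 d dT; rewrite /load2.
case: (two_cases u) => [|->//|uD _]; last by rewrite (closed d u) ?orbT.
by rewrite !in_cons in_nil orbF => /or3P[]/eqP uu; rewrite uu in du;
  rewrite ?du ?addn1 //; move: du; rewrite adjC nbv (negbTE dx) (negbTE dy).
Qed.

Lemma part_nadj T T' t t' : part T -> part T' -> [disjoint T & T'] ->
  t \in T -> t' \in T' -> ~~ adj G t t'.
Proof.
move=> partT partT' dTT tT t'T; apply: contraL t'T => tt'.
have := part_nbr partT tT tt'; case t'T : (t' \in T') => //.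
have [_ _ _ /negbTE ->] := rest_out (part_rest partT' t'T).
by rewrite (disjointFl dTT t'T).
Qed.

Lemma strong_neq d d' : strong d d' -> P d != P d'.
Proof.
by move=> /exists_inP[b bP /eqP e]; apply: contraTneq bP => ->; rewrite -e coreN_self.
Qed.

Lemma covers_strong d d' : d \in D -> covers d d' -> strong d d'.
Proof.
move=> dD /forall_inP tot; have /card_gt0P[b bP] : 0 < #|P d|.
  by rewrite coreN_card degin_core_rest.
by apply/exists_inP; exists b; rewrite ?tot.
Qed.

(** [a1] and [a2] are adjacent to [d'] in [T'] and to [b1] in [T], so they lie in the core and form
    both [P d'] and [P b1]. *)
Lemma link_beta T T' d d' a1 a2 b1 b2 : part T -> part T' -> [disjoint T & T'] ->
  d \in T -> d' \in T' -> a1 != a2 -> b1 != b2 ->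
  adj G d' a1 && adj G d' a2 -> adj G d b1 && adj G d b2 ->
  [&& adj G a1 b1, adj G a1 b2, adj G a2 b1 & adj G a2 b2] ->
  b1 \in T -> beta T d d'.
Proof.
move=> pT pT' dis dT dT' a12 b12 /andP[da1 da2] /andP[db1 db2] /and4P[h11 h12 h21 h22] b1T.
have inC a : adj G d' a -> adj G a b1 -> a \in C.
  move=> da ab; have /orP[//|aT] := part_nbr pT' dT' da.
  by have := part_nadj pT pT' dis b1T aT; rewrite adjC ab.
have a1C := inC a1 da1 h11; have a2C := inC a2 da2 h21.
have Pd' : P d' = [set a1; a2].
  by apply: coreN_eq; rewrite // rest_notin ?(part_rest pT').
have Pb b : b \notin [:: v; x; y] -> adj G a1 b -> adj G a2 b -> P b = P d'.
  by move=> bn ab1 ab2; rewrite Pd'; apply: coreN_eq; rewrite // adjC.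
have Pb1 : P b1 = P d' by apply: Pb; rewrite // rest_notin ?(part_rest pT).
apply/andP; split; first by apply/exists_inP; exists b1; rewrite // db1 Pb1 eqxx.
have /orP[b2C|b2T] := part_nbr pT dT db2; apply/orP.
  left; apply/exists_inP; exists b2; first by rewrite inE b2C db2.
  by apply/eqP; apply: Pb; rewrite // core_notin.
right; apply/degin_gt1P; exists b1, b2; rewrite !inE b1T b2T Pb1 eqxx db1 db2 b12.
by split=> //; apply/eqP; apply: Pb; rewrite // rest_notin ?(part_rest pT).
Qed.

Lemma part_link T T' d d' : part T -> part T' -> [disjoint T & T'] ->
  d \in T -> d' \in T' ->
  [\/ covers d d' && covers d' d, beta T d d' | beta T' d' d].
Proof.
move=> pT pT' dis dT dT'.
have ndd' := part_nadj pT pT' dis dT dT'.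
have dd' : d != d' by apply: contraTneq dT => ->; rewrite (disjointFl dis dT').
have [a1 [a2 [b1 [b2 [a12 b12 da db ab]]]]] := saturated_link satG dd' ndd'.
have dis' : [disjoint T' & T] by rewrite disjoint_sym.
have [h11 h12 h21 h22] := and4P ab.
have [da1 da2] := andP da; have [db1 db2] := andP db.
have ab' : [&& adj G a1 b2, adj G a1 b1, adj G a2 b2 & adj G a2 b1].
  by rewrite h11 h12 h21 h22.
have ba : [&& adj G b1 a1, adj G b1 a2, adj G b2 a1 & adj G b2 a2].
  by rewrite !(adjC G b1) !(adjC G b2) h11 h12 h21 h22.
have ba' : [&& adj G b1 a2, adj G b1 a1, adj G b2 a2 & adj G b2 a1].
  by rewrite !(adjC G b1) !(adjC G b2) h11 h12 h21 h22.
have b21 : b2 != b1 by rewrite eq_sym.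
have a21 : a2 != a1 by rewrite eq_sym.
have db' : adj G d b2 && adj G d b1 by rewrite andbC.
have da' : adj G d' a2 && adj G d' a1 by rewrite andbC.
have /orP[b1C|b1T] := part_nbr pT dT db1; last first.
  by constructor 2; apply: (link_beta pT pT' dis dT dT' a12 b12 da db ab).
have /orP[b2C|b2T] := part_nbr pT dT db2; last first.
  by constructor 2; apply: (link_beta pT pT' dis dT dT' a12 b21 da db' ab').
have /orP[a1C|a1T] := part_nbr pT' dT' da1; last first.
  by constructor 3; apply: (link_beta pT' pT dis' dT' dT b12 a12 db da ba).
have /orP[a2C|a2T] := part_nbr pT' dT' da2; last first.
  by constructor 3; apply: (link_beta pT' pT dis' dT' dT b12 a21 db da' ba').
have Pd : P d = [set b1; b2] by apply: coreN_eq; rewrite // rest_notin ?(part_rest pT).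
have Pd' : P d' = [set a1; a2] by apply: coreN_eq; rewrite // rest_notin ?(part_rest pT').
constructor 1; apply/andP; split; apply/forall_inP => c.
  rewrite Pd in_set2 Pd' => /orP[]/eqP ->; apply/eqP;
  by apply: coreN_eq; rewrite ?core_notin // adjC.
rewrite Pd' in_set2 Pd => /orP[]/eqP ->; apply/eqP;
by apply: coreN_eq; rewrite ?core_notin.
Qed.

Definition leaf T d := (d \in T) && (degin G T d <= 1).

Lemma leaf_hits_twice T d d' : leaf T d -> hits_twice T d d' = false.
Proof.
move=> /andP[_ le1]; apply/negbTE; rewrite -leqNgt; apply: leq_trans le1.
by apply/degin_sub/subsetP => t; rewrite inE => /andP[].
Qed.

Lemma leaf_hits T d d1 d2 : leaf T d -> hits T d d1 -> hits T d d2 -> P d1 = P d2.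
Proof.
move=> /andP[_ le1] /exists_inP[t tT /andP[dt /eqP <-]] /exists_inP[u uT /andP[du /eqP <-]].
by rewrite (degin_le1 le1 tT uT dt du).
Qed.

(** For a leaf the first case is [beta], since a leaf never hits twice; mutual covering counts as an
    arrow both ways. *)
Definition arrow T d d' := [&& hits T d d' & strong d d'] || (covers d d' && covers d' d).

(** The target pair is read off from the unique neighbour of the leaf in [T], or from a vertex [b]
    of [P d]. *)
Lemma arrow_eq T d d1 d2 : leaf T d -> arrow T d d1 -> arrow T d d2 -> d \in D -> P d1 = P d2.
Proof.
move=> lf + + dD.
have st e1 e2 : strong d e1 -> covers d e2 -> P e1 = P e2.
  by move=> /exists_inP[b bP /eqP <-] /forall_inP/(_ b bP)/eqP.
move=> /orP[/andP[o1 s1]|/andP[t1 _]] /orP[/andP[o2 s2]|/andP[t2 _]].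
- exact: leaf_hits lf o1 o2.
- exact: st.
- by apply/esym/st.
- exact: st (covers_strong dD t1) t2.
Qed.

Lemma leaf_link T T' d d' : part T -> part T' -> [disjoint T & T'] ->
  leaf T d -> leaf T' d' -> P d != P d' /\ (arrow T d d' \/ arrow T' d' d).
Proof.
move=> pT pT' dis lf lf'; have [/andP[dT _] /andP[dT' _]] := (lf, lf').
have [dD dD'] := (part_rest pT dT, part_rest pT' dT').
case: (part_link pT pT' dis dT dT') => [/[dup] tt /andP[t1 _]|/andP[o]|/andP[o]].
- by rewrite (strong_neq (covers_strong dD t1)) /arrow tt orbT; split=> //; left.
- rewrite leaf_hits_twice // orbF => s; rewrite (strong_neq s) /arrow o s; split=> //; by left.
- rewrite leaf_hits_twice // orbF => s; rewrite eq_sym (strong_neq s) /arrow o s; split=> //; by right.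
Qed.

Lemma cycle_contra T1 T2 d1 d2 d3 : part T1 -> part T2 -> [disjoint T1 & T2] ->
  leaf T1 d1 -> leaf T2 d2 -> P d1 != P d2 -> P d2 != P d3 ->
  hits T1 d1 d2 -> strong d1 d2 -> hits T2 d2 d3 -> False.
Proof.
move=> p1 p2 dis lf1 /andP[d2T _] n12 n23 o12 s12 /exists_inP[t tT /andP[d2t /eqP Pt]].
have /andP[d1T _] := lf1; have d1D := part_rest p1 d1T.
(* Link [d1] to [t]: the arrow from [d1] already points to [P d2], which differs from [P t], so only
   [beta T2 t d1] remains. *)
have [s sT Ps] : exists2 s, s \in T2 & P s = P d1.
  case: (part_link p1 p2 dis d1T tT) => [/andP[/forall_inP tot _]|/andP[o _]|/andP[o _]].
  - have /exists_inP[b bP /eqP Pb] := s12.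
    by have /eqP := tot b bP; rewrite Pb Pt => e; rewrite e eqxx in n23.
  - by have := leaf_hits lf1 o12 o; rewrite Pt => e; rewrite e eqxx in n23.
  - by have /exists_inP[s sT /andP[_ /eqP Ps]] := o; exists s.
have [_ _ sp _ _] := p2.
(* Linking [d1] to any [w] of this set forces two neighbours of [w] inside the set, which is
   impossible in a forest. *)
have [||w] := sp [set w in T2 | P w == P d1].
- by apply/subsetP => w; rewrite inE => /andP[].
- by apply/set0Pn; exists s; rewrite inE sT Ps eqxx.
rewrite inE => /andP[wT /eqP Pw] le1.
case: (part_link p1 p2 dis d1T wT) => [/andP[tot _]|/andP[o _]|/andP[_ /orP[st|tw]]].
- by have := strong_neq (covers_strong d1D tot); rewrite Pw eqxx.
- by have e := leaf_hits lf1 o12 o; rewrite -Pw -e eqxx in n12.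
- by have := strong_neq st; rewrite Pw eqxx.
- by move: tw; rewrite /hits_twice ltnNge le1.
Qed.

Lemma arrow_cycle T1 T2 T3 d1 d2 d3 : part T1 -> part T2 -> [disjoint T1 & T2] ->
  leaf T1 d1 -> leaf T2 d2 -> P d1 != P d2 -> P d2 != P d3 -> P d1 != P d3 ->
  arrow T1 d1 d2 -> arrow T2 d2 d3 -> arrow T3 d3 d1 -> False.
Proof.
move=> p1 p2 dis lf1 lf2 n12 n23 n13 a12 a23 a31.
have [/andP[d1T _] /andP[d2T _]] := (lf1, lf2).
have [d1D d2D] := (part_rest p1 d1T, part_rest p2 d2T).
have [/andP[o12 s12]|/andP[t12 t21]] := orP a12; last first.
  have a21 : arrow T2 d2 d1 by rewrite /arrow t12 t21 orbT.
  by have e := arrow_eq lf2 a21 a23 d2D; rewrite e eqxx in n13.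
have [/andP[o23 _]|/andP[t23 t32]] := orP a23.
  exact: (cycle_contra p1 p2 dis lf1 lf2 n12 n23 o12 s12 o23).
have a32 : arrow T3 d3 d2 by rewrite /arrow t23 t32 orbT.
have [/andP[o31 s31]|/andP[t31 t13]] := orP a31.
  have /exists_inP[b bP /eqP Pb] := s31.
  by have /forall_inP/(_ b bP)/eqP := t32; rewrite Pb => e; rewrite e eqxx in n12.
have a13 : arrow T1 d1 d3 by rewrite /arrow t13 t31 orbT.
by have e := arrow_eq lf1 a12 a13 d1D; rewrite e eqxx in n23.
Qed.

Lemma part_leaf T : part T -> exists d, leaf T d.
Proof.
by move=> [_ T0 sp _ _]; have [d dT le1] := sp T (subxx T) T0; exists d; rewrite /leaf dT.
Qed.

Lemma no_three_parts T1 T2 T3 : part T1 -> part T2 -> part T3 ->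
  [disjoint T1 & T2] -> [disjoint T2 & T3] -> [disjoint T1 & T3] -> False.
Proof.
move=> p1 p2 p3 dis12 dis23 dis13.
have [d1 lf1] := part_leaf p1; have [d2 lf2] := part_leaf p2.
have [d3 lf3] := part_leaf p3.
have [/andP[d1T _] /andP[d2T _] /andP[d3T _]] := And3 lf1 lf2 lf3.
have d1D := part_rest p1 d1T; have d2D := part_rest p2 d2T; have d3D := part_rest p3 d3T.
have [n12 a12] := leaf_link p1 p2 dis12 lf1 lf2.
have [n23 a23] := leaf_link p2 p3 dis23 lf2 lf3.
have [n13 a13] := leaf_link p1 p3 dis13 lf1 lf3.
have dis21 : [disjoint T2 & T1] by rewrite disjoint_sym.
have [n21 n32 n31] : [/\ P d2 != P d1, P d3 != P d2 & P d3 != P d1] by rewrite ![P d3 == _]eq_sym eq_sym.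
(* Two arrows out of the same leaf would identify two distinct pairs, so the three arrows form a
   directed cycle. *)
case: a12 => [h12|h21].
  case: a13 => [h13|h31]; first by have e := arrow_eq lf1 h12 h13 d1D; rewrite e eqxx in n23.
  case: a23 => [h23|h32]; last by have e := arrow_eq lf3 h31 h32 d3D; rewrite e eqxx in n12.
  exact: (arrow_cycle p1 p2 dis12 lf1 lf2 n12 n23 n13 h12 h23 h31).
case: a23 => [h23|h32]; first by have e := arrow_eq lf2 h21 h23 d2D; rewrite e eqxx in n13.
case: a13 => [h13|h31]; last by have e := arrow_eq lf3 h31 h32 d3D; rewrite e eqxx in n12.
exact: (arrow_cycle p2 p1 dis21 lf2 lf1 n21 n13 n23 h21 h13 h32).
Qed.

Lemma two_edges_large : 3 * #|V| - 9 <= #|edges G|.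
Proof.
have := edges_two; rewrite card_two.
case: (three_parts G load2 D) => [|[T1 [T2 [T3 [[p1 p2 p3] [d12 d23 d13]]]]]]; last first.
  by case: (no_three_parts p1 p2 p3 d12 d23 d13).
by rewrite /weight; move: (\sum_(d in D) _) => m; lia.
Qed.

(** The 2-regular core has at least three vertices; with four, with the edge [xy] or with a load,
    the count suffices. Otherwise the link of [x] and [y] places four vertices in the core. *)
Lemma two_edges_small : 4 <= #|V| -> 2 * #|V| <= #|edges G|.
Proof.
move=> n4; have e2 := edges_two; have cV := card_two.
have [c cC] : exists c, c \in C.
  have [w wn] : exists w, w \notin [:: v; x; y].
    apply/existsP; apply: contraT => /existsPn all3.
    have : #|V| <= size [:: v; x; y]; last by rewrite leqNgt n4.
    apply: leq_trans (card_size _); apply/subset_leq_card/subsetP => w _.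
    by have := all3 w; rewrite negbK.
  have /ltnW/degin_gt0P[c cC _] : 1 < degin G C w by rewrite degin_core.
  by exists c.
have C3 : 3 <= #|C|.
  have /degin_gt1P[a [b [aC bC ab ca cb]]] : 1 < degin G C c by rewrite degin_core_in.
  by apply/card_gt2P; exists c, a, b; rewrite (adj_neq ca) ab eq_sym (adj_neq cb).
case: (ltnP 3 #|C|) => [|le3]; first by lia.
case: (boolP (adj G x y)) => [axy|naxy]; first by move: e2; rewrite axy; lia.
case: (posnP (\sum_(d in D) load2 d)) => [load0|pos]; last first.
  have : 2 * \sum_(d in D) load2 d <= \sum_(d in D) (degin G D d + 2 * load2 d).
    by rewrite big_distrr; apply: leq_sum => d _; apply: leq_addl.
  by move: e2 pos; move: (\sum_(d in D) load2 d) (\sum_(d in D) _) => l m; lia.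
have noload d : d \in D -> (adj G d x = false) * (adj G d y = false).
  move=> dD; have : load2 d <= 0.
    by rewrite -load0; have := @sum_ge_seq _ D load2 [:: d]; rewrite big_seq1 /= dD => ->.
  by rewrite /load2; case: adj; case: adj.
have [a1 [a2 [b1 [b2 [a12 b12 /andP[ya1 ya2] /andP[xb1 xb2] /and4P[h11 h12 h21 h22]]]]]] :=
  saturated_link satG nxy naxy.
suff : 3 < #|C| by rewrite ltnNge le3.
have inC z u : (z == x) || (z == y) -> adj G z u -> u != v -> u \in C.
  move=> zxy zu uv; case: (two_cases u) => [|//|uD].
    rewrite !in_cons in_nil orbF (negbTE uv) /= => /orP[]/eqP e; move: zxy zu; rewrite e;
    by move=> /orP[]/eqP ->; rewrite ?(adj_irr G) ?(adjC G y x) ?(negbTE naxy).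
  by move: zxy zu => /orP[]/eqP ->; rewrite adjC ?(noload u uD).
have vb b c1 c2 z : c1 != c2 -> (z == x) || (z == y) -> adj G z c1 -> adj G z c2 ->
    adj G b c1 -> adj G b c2 -> b != v.
  move=> c12 zxy z1 z2 bc1 bc2; apply/eqP => bv; rewrite bv in bc1 bc2.
  move: bc1 bc2 c12 zxy z1 z2; rewrite !nbv => /orP[]/eqP -> /orP[]/eqP ->; rewrite ?eqxx //;
  by move=> _ /orP[]/eqP ->; rewrite ?(adj_irr G).
have xP : (x == x) || (x == y) by rewrite eqxx.
have yP : (y == x) || (y == y) by rewrite eqxx orbT.
have a1C : a1 \in C by apply: (inC y) => //; apply: (vb a1 b1 b2 x).
have a2C : a2 \in C by apply: (inC y) => //; apply: (vb a2 b1 b2 x).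
have b1C : b1 \in C by apply: (inC x) => //; apply: (vb b1 a1 a2 y); rewrite // adjC.
have b2C : b2 \in C by apply: (inC x) => //; apply: (vb b2 a1 a2 y); rewrite // adjC.
rewrite -sum1_card; have := @sum_ge_seq _ C (fun=> 1) [:: a1; a2; b1; b2].
rewrite !big_cons big_nil /= a1C a2C b1C b2C !in_cons in_nil !orbF !negb_or a12 b12.
by rewrite (adj_neq h11) (adj_neq h12) (adj_neq h21) (adj_neq h22); apply.
Qed.

End Two.

Lemma degree2_nbrs (V : finType) (G : sgraph V) v : degree G v = 2 ->
  exists x y, x != y /\ forall w, adj G v w = (w == x) || (w == y).
Proof.
move=> /eqP/cards2P[x [y [nxy e]]]; exists x, y; split=> // w.
by have /setP/(_ w) := e; rewrite !inE.
Qed.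

(** * Extremal graphs *)

Lemma saturated_min2 (V : finType) (G : sgraph V) v :
  3 <= #|V| -> saturated (Kbip 3 3) G -> 2 <= degree G v.
Proof.
move=> n3 satG; rewrite leqNgt; apply/negP => lt2.
have [w wv nvw] : exists2 w, v != w & ~~ adj G v w.
  apply/exists_inP; apply: contraT; rewrite negb_exists_in => /forall_inP h.
  have : #|V| <= #|v |: [set w | adj G v w]|.
    apply/subset_leq_card/subsetP => w _; rewrite !inE eq_sym.
    by case: (eqVneq v w) => //= vw; rewrite -[adj _ _ _]negbK h.
  by rewrite cardsU1; move: lt2; rewrite /degree; case: (_ \notin _); lia.
have [a1 [a2 [b1 [b2 [_ b12 _ /andP[vb1 vb2] _]]]]] := saturated_link satG wv nvw.
have : 1 < degree G v; last by rewrite ltnNge -ltnS lt2.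
by rewrite degreeE; apply/degin_gt1P; exists b1, b2; rewrite !inE.
Qed.

Lemma count_gt1 (T : eqType) (p : pred T) (s : seq T) :
  uniq s -> 1 < count p s -> exists x y, [/\ x \in s, y \in s, x != y, p x & p y].
Proof.
move=> us; rewrite -size_filter; have := filter_uniq p us.
have : forall z, z \in filter p s -> p z /\ z \in s by move=> z; rewrite mem_filter => /andP.
case: (filter p s) => [|x [|y t]] //= ps /andP[]; rewrite inE negb_or => /andP[xy _] _ _.
have [px xs] := ps x (mem_head _ _); have [|py ys] := ps y; first by rewrite !inE eqxx orbT.
by exists x, y.
Qed.

Section Extension.
Variables (r : rel nat) (o m : nat).

Definition tab_link i j : bool :=
  has (fun a1 => has (fun a2 => (a1 != a2) &&
      (1 < count (fun b => [&& r i b, r a1 b & r a2 b]) (iota 0 o)))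
    [seq a <- iota 0 o | r j a]) [seq a <- iota 0 o | r j a].

Definition hub_link w : bool :=
  1 < count (fun a => [&& r w a, r a 1 & r a 2]) (iota 0 o).

(** Nonadjacent pairs are linked, no three vertices have three common neighbours, and a vertex not
    joined to both 1 and 2 is a hub or can be linked to any triangle vertex through them. *)
Definition tab_check : bool :=
  [&& all (fun i => all (fun j => [|| i == j, r i j | tab_link i j]) (iota 0 o)) (iota 0 o),
      all (fun p => all (fun q => all (fun s => [|| p == q, q == s, s == p |
         count (fun c => [&& r p c, r q c & r s c]) (iota 0 o) <= 2])
         (iota 0 o)) (iota 0 o)) (iota 0 o) &
      all (fun w => [|| w == 1, w == 2, r w 1 && r w 2 | hub_link w]) (iota 0 o)].

Definition hub i := (i == 1) || (i == 2).

(* m triangles, joined to the vertices 1 and 2, are added to the graph of r on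
   {0, ..., o - 1}. *)
Definition ext_rel (i j : nat) : bool :=
  if i < o then if j < o then r i j else hub i
  else if j < o then hub j else (i != j) && ((i - o) %/ 3 == (j - o) %/ 3).

Hypotheses (r_sym : symmetric r) (r_irr : irreflexive r) (o3 : 3 <= o).

Definition ext_adj : rel 'I_(o + 3 * m) := fun i j => ext_rel i j.

Lemma ext_adj_sym : symmetric ext_adj.
Proof.
move=> i j; rewrite /ext_adj /ext_rel; case: (i < o); case: (j < o) => //.
by rewrite eq_sym; congr (_ && _); rewrite eq_sym.
Qed.

Lemma ext_adj_irr : irreflexive ext_adj.
Proof. by move=> i; rewrite /ext_adj /ext_rel r_irr eqxx; case: (i < o). Qed.

Definition ext_graph : sgraph 'I_(o + 3 * m) := SGraph ext_adj_sym ext_adj_irr.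

Hypothesis ok : tab_check.

Lemma ext_small i j : i < o -> j < o -> ext_rel i j = r i j.
Proof. by rewrite /ext_rel => -> ->. Qed.

Lemma ext_hub i j : i < o -> o <= j -> ext_rel i j = hub i.
Proof. by move=> io oj; rewrite /ext_rel io ltnNge oj. Qed.

Lemma ext_far i j : o <= i -> o <= j ->
  ext_rel i j = (i != j) && ((i - o) %/ 3 == (j - o) %/ 3).
Proof. by move=> oi oj; rewrite /ext_rel !ltnNge oi oj. Qed.

Lemma ext_block i t : o <= t -> ext_rel t i -> 
  i \in [:: 1; 2; o + (t - o) %/ 3 * 3; o + (t - o) %/ 3 * 3 + 1; o + (t - o) %/ 3 * 3 + 2].
Proof.
rewrite /ext_rel ltnNge => ->/=; rewrite !inE; case: ltnP => [_ /orP[]->|]; rewrite ?orbT //.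
by lia.
Qed.

(** A copy outside the table has a triangle vertex on each side, both in the same triangle; its six
    vertices would lie among that triangle and the two hubs. *)
Lemma ext_free : ~ contains (Kbip 3 3) ext_graph.
Proof.
move=> [f [finj fadj]].
have fvinj : injective (fun z => f z : nat) by move=> z z' /val_inj; apply: finj.
have fr z z' : Kbip_rel z z' -> ext_rel (f z) (f z') by apply: fadj.
case: (boolP [forall z, f z < o]) => [/forallP fo|].
  have /and3P[_ /allP free _] := ok.
  pose p i := f (inl i) : nat; pose q j := f (inr j) : nat.
  have pq i j : r (p i) (q j) by rewrite -(ext_small (fo _) (fo _)); apply: fr.
  have in_o z : (f z : nat) \in iota 0 o by rewrite mem_iota fo.
  pose i0 : 'I_3 := @Ordinal 3 0 isT; pose i1 : 'I_3 := @Ordinal 3 1 isT.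
  pose i2 : 'I_3 := @Ordinal 3 2 isT.
  have := allP (allP (free _ (in_o (inl i0))) _ (in_o (inl i1))) _ (in_o (inl i2)).
  rewrite !(inj_eq fvinj) /= => le2.
  have : size [:: q i0; q i1; q i2] <= size [seq c <- iota 0 o | [&& r (p i0) c, r (p i1) c & r (p i2) c]].
    apply: uniq_leq_size; first by rewrite /= !inE !(inj_eq fvinj).
    move=> c; rewrite mem_filter !inE => /or3P[]/eqP ->; rewrite !pq /=; exact: in_o.
  by rewrite size_filter leqNgt ltnS le2.
rewrite negb_forall => /existsP[z]; rewrite -leqNgt => oz.
pose nb (j : 'I_3) : 'I_3 + 'I_3 := if z is inl _ then inr j else inl j.
have nb_adj j : Kbip_rel z (nb j) by rewrite /nb; case: (z).
have nb_inj : injective nb by rewrite /nb; case: (z) => ? j j' [].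
have [j oj] : exists j, o <= f (nb j).
  apply/existsP; apply: contraT => /existsPn small.
  have : size [seq (f (nb j) : nat) | j <- enum 'I_3] <= size [:: 1; 2].
    apply: uniq_leq_size.
      by rewrite map_inj_uniq ?enum_uniq // => j j' /fvinj/nb_inj.
    move=> c /mapP[j _ ->]; have := fr _ _ (nb_adj j).
    rewrite /ext_rel ltnNge oz /= ltnNge (negbTE (small j)) /= !inE; exact.
  by rewrite size_map size_enum_ord.
have same : (f (nb j) - o) %/ 3 = (f z - o) %/ 3.
  by have := fr _ _ (nb_adj j); rewrite ext_far // => /andP[_ /eqP ->].
have : size [seq (f y : nat) | y <- enum {: 'I_3 + 'I_3}] <= size [:: 1; 2; o + (f z - o) %/ 3 * 3;
    o + (f z - o) %/ 3 * 3 + 1; o + (f z - o) %/ 3 * 3 + 2].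
  apply: uniq_leq_size; first by rewrite map_inj_uniq ?enum_uniq.
  move=> c /mapP[y _ ->].
  have [yz|yz] : Kbip_rel z y \/ Kbip_rel (nb j) y.
    by rewrite /nb; case: (z) => ?; case: (y) => ?; [right|left|left|right].
  - exact: ext_block (fr _ _ yz).
  - by rewrite -same; apply: ext_block (fr _ _ yz).
by rewrite size_map -cardE card_sum !card_ord.
Qed.

Lemma ext_linked (u w : 'I_(o + 3 * m)) : u != w -> ~~ adj ext_graph u w -> link ext_graph u w.
Proof.
have /and3P[/allP pairs _ /allP hubs] := ok.
have oI i : i < o -> i < o + 3 * m by lia.
have main (t x : 'I_(o + 3 * m)) : o <= t -> t != x -> ~~ adj ext_graph t x -> link ext_graph t x.
  move=> ot tx ntx; have one := oI 1 (ltnW o3); have two := oI 2 o3.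
  have [o1 o2] : 1 < o /\ 2 < o by lia.
  case: (boolP (ext_rel x 1 && ext_rel x 2)) => [/andP[x1 x2]|nx].
    (* The vertex [c] steps after [t], cyclically in its triangle; the two others are linked with
       the hubs. *)
    pose b c := o + (t - o) %/ 3 * 3 + ((t - o) %% 3 + c) %% 3.
    have bI c : b c < o + 3 * m by rewrite /b; have := ltn_ord t; lia.
    have ob c : o <= b c by rewrite /b; lia.
    have tb c : 0 < c < 3 -> ext_rel t (b c).
      by move=> c3; rewrite ext_far // /b; lia.
    have bh c h : h < o -> hub h -> ext_rel h (b c) by move=> ho hh; rewrite ext_hub.
    exists (Ordinal one), (Ordinal two), (Ordinal (bI 1)), (Ordinal (bI 2)); split=> //.
    - by rewrite -val_eqE /= /b; lia.
    - by rewrite /= /ext_adj /= x1 x2.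
    - by rewrite /= /ext_adj /= !tb.
    - by rewrite /= /ext_adj /= !bh.
  have xo : x < o.
    by rewrite ltnNge; apply: contra nx => ox; rewrite /ext_rel ltnNge ox /= o1 o2.
  have := hubs x; rewrite mem_iota xo => /(_ isT).
  rewrite !ext_small // in nx; rewrite (negbTE nx) /= orbA => /orP[hx|].
    by move: ntx; rewrite /= /ext_adj /ext_rel ltnNge ot /= xo /hub hx.
  move=> /(count_gt1 (iota_uniq 0 o))[a1 [a2 []]]; rewrite !mem_iota.
  move=> a1o a2o na /and3P[xa1 a11 a12] /and3P[xa2 a21 a22].
  exists (Ordinal (oI a1 a1o)), (Ordinal (oI a2 a2o)), (Ordinal one), (Ordinal two); split=> //.
  - by rewrite /= /ext_adj /= !ext_small // xa1 xa2.
  - by rewrite /= /ext_adj /ext_rel /= ltnNge ot o1 o2.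
  - by rewrite /= /ext_adj /= !ext_small // a11 a12 a21 a22.
case: (leqP o u) => [ou|uo]; first exact: main.
case: (leqP o w) => [ow|wo] uw nuw.
  by apply: linkC; apply: main; rewrite // 1?eq_sym // adjC.
have := allP (pairs u _) w; rewrite !mem_iota uo wo => /(_ isT isT).
move: nuw; rewrite /= {1}/ext_adj ext_small // => nuw.
rewrite val_eqE (negbTE uw) (negbTE nuw) /=.
move=> /hasP[a1]; rewrite mem_filter mem_iota => /andP[wa1 a1o] /hasP[a2].
rewrite mem_filter mem_iota => /andP[wa2 a2o] /andP[na].
move=> /(count_gt1 (iota_uniq 0 o))[b1 [b2 []]]; rewrite !mem_iota.
move=> b1o b2o nb /and3P[ub1 a1b1 a2b1] /and3P[ub2 a1b2 a2b2].
exists (Ordinal (oI a1 a1o)), (Ordinal (oI a2 a2o)), (Ordinal (oI b1 b1o)), (Ordinal (oI b2 b2o)).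
split=> //; rewrite /= /ext_adj /= !ext_small //.
- by rewrite wa1 wa2.
- by rewrite ub1 ub2.
- by rewrite a1b1 a1b2 a2b1 a2b2.
Qed.

Lemma ext_saturated : saturated (Kbip 3 3) ext_graph.
Proof. exact: saturatedP ext_free ext_linked. Qed.


(** The set [rest] for the vertex 0 with neighbours 1 and 2; triangle vertices belong to the core,
    so a finite table suffices. *)
Definition rest_seq : seq nat :=
  [seq i <- iota 0 o | [&& i != 0, i != 1, i != 2 & ~~ (r 1 i && r 2 i)]].

Definition rest_weight : nat :=
  sumn [seq sumn [seq (r i j : nat) | j <- rest_seq] + 2 * (r i 1 + r i 2) | i <- rest_seq].

Hypothesis apex : all (fun w => r 0 w == hub w) (iota 0 o).

Let n3 : 3 <= o + 3 * m. Proof. exact: leq_trans (leq_addr _ _). Qed.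
Let x0 : 'I_(o + 3 * m) := Ordinal (ltnW (ltnW n3)).
Let x1 : 'I_(o + 3 * m) := Ordinal (ltnW n3).
Let x2 : 'I_(o + 3 * m) := Ordinal n3.

Lemma ext_apex w : adj ext_graph x0 w = (w == x1) || (w == x2).
Proof.
rewrite /= /ext_adj /ext_rel -!val_eqE /= (ltnW (ltnW o3)); case: ltnP => [wo|ow].
  by rewrite (eqP (allP apex w _)) // mem_iota.
by rewrite /hub /=; lia.
Qed.

Lemma ext_apex_degree : degree ext_graph x0 = 2.
Proof.
rewrite /degree (_ : [set w | _] = [set x1; x2]) ?cards2 //.
by apply/setP => w; rewrite inE ext_apex !inE.
Qed.

Lemma ext_rest (w : 'I_(o + 3 * m)) : (w \in rest ext_graph x0 x1 x2) =
  (w < o) && [&& w != 0 :> nat, w != 1 :> nat, w != 2 :> nat & ~~ (r 1 w && r 2 w)].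
Proof.
rewrite [LHS]inE coreE /= /ext_adj /ext_rel -!val_eqE /= (ltnW o3) o3.
by case: (w < o); case: (w == 0 :> nat); case: (w == 1 :> nat); case: (w == 2 :> nat).
Qed.

Lemma sum_ext_rest (F : nat -> nat) :
  \sum_(w in rest ext_graph x0 x1 x2) F w = sumn [seq F i | i <- rest_seq].
Proof.
rewrite (eq_bigl _ _ ext_rest).
rewrite -(big_mkord (fun i => (i < o) && [&& i != 0, i != 1, i != 2 & ~~ (r 1 i && r 2 i)]) F).
under eq_bigl do rewrite andbC.
rewrite -(big_nat_widen _ _ _ (fun i => [&& i != 0, i != 1, i != 2 & ~~ (r 1 i && r 2 i)])) ?leq_addr //.
by rewrite sumnE big_map big_filter /index_iota subn0.
Qed.

Lemma ext_edges :
  2 * #|edges ext_graph| + 14 + 2 * size rest_seq =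
  6 * (o + 3 * m) + 2 * r 1 2 + rest_weight.
Proof.
have n12 : x1 != x2 by [].
have := edges_two ext_saturated ext_apex n12; have := card_two ext_apex n12.
rewrite card_ord /= {1}/ext_adj ext_small ?(ltnW o3) //=.
have -> : #|rest ext_graph x0 x1 x2| = size rest_seq.
  by rewrite -sum1_card (sum_ext_rest (fun=> 1)) sumnE big_map sum1_size.
have -> : \sum_(w in rest ext_graph x0 x1 x2)
    (degin ext_graph (rest ext_graph x0 x1 x2) w + 2 * load2 ext_graph x1 x2 w) = rest_weight.
  rewrite /rest_weight -sum_ext_rest; apply: eq_bigr => w; rewrite ext_rest => /andP[wo _].
  congr (_ + 2 * _); last by rewrite /load2 /= /ext_adj !ext_small // ltnW.
  rewrite -(sum_ext_rest (fun j => r w j)); apply: eq_bigr => u; rewrite ext_rest => /andP[uo _].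
  by rewrite /= /ext_adj ext_small.
by move: rest_weight => W; lia.
Qed.

Lemma ext_min_degree : min_degree_is ext_graph 2.
Proof.
split; first by exists x0; apply: ext_apex_degree.
by move=> k [u <-]; apply: saturated_min2 ext_saturated; rewrite card_ord.
Qed.

End Extension.

(** The octahedron has antipodal pairs {1, 2}, {3, 5}, {4, 6}; 0 is joined to the first, 7 and 9 to
    the second, 8 and 10 to the third. The numbering lets the first 7 to 11 vertices be kept. *)
Definition octahedron_edges : seq (nat * nat) :=
  [:: (0, 1); (0, 2);
      (1, 3); (1, 4); (1, 5); (1, 6); (2, 3); (2, 4); (2, 5); (2, 6);
      (3, 4); (4, 5); (5, 6); (3, 6);
      (7, 3); (7, 5); (9, 3); (9, 5); (7, 9);
      (8, 4); (8, 6); (10, 4); (10, 6); (8, 10)].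

Definition octahedron_rel : rel nat :=
  fun i j => ((i, j) \in octahedron_edges) || ((j, i) \in octahedron_edges).

Lemma octahedron_sym : symmetric octahedron_rel.
Proof. by move=> i j; rewrite /octahedron_rel orbC. Qed.

Lemma octahedron_irr : irreflexive octahedron_rel.
Proof.
have loopless : all (fun p => p.1 != p.2) octahedron_edges by [].
by move=> i; rewrite /octahedron_rel orbb; apply/negP => /(allP loopless); rewrite eqxx.
Qed.

Lemma octahedron_ok o : 7 <= o <= 11 ->
  [/\ tab_check octahedron_rel o, all (fun w => octahedron_rel 0 w == hub w) (iota 0 o),
      octahedron_rel 1 2 = false, size (rest_seq octahedron_rel o) = o - 7 &
      rest_weight octahedron_rel o = 2 * (o - 9)].
Proof.
by do 7![case: o => [|o]; first by []]; do 5![case: o => [|o]; first by vm_compute].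
Qed.

(** On six vertices this is a complete graph on 1 to 5 with 0 joined to 1 and 2, which has 12
    edges. *)
Definition star_rel : rel nat :=
  fun i j => [&& i != j, (i == 0) ==> hub j & (j == 0) ==> hub i].

Lemma star_sym : symmetric star_rel.
Proof. by move=> i j; rewrite /star_rel eq_sym [X in _ && X]andbC. Qed.

Lemma star_irr : irreflexive star_rel.
Proof. by move=> i; rewrite /star_rel eqxx. Qed.

(** Truncated subtraction makes one formula give [2 * n] edges for [o <= 8] and [m = 0], and
    [3 * n - 9] for [9 <= o], where [n] is [o + 3 * m]. *)
Lemma octahedron_sizes o m : 7 <= o <= 11 ->
  exists G : sgraph 'I_(o + 3 * m),
    [/\ saturated (Kbip 3 3) G, min_degree_is G 2 &
        2 * #|edges G| + 2 * o = 6 * (o + 3 * m) + 2 * (o - 9)].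
Proof.
move=> o711; have [ok apex r12 sz wt] := octahedron_ok o711.
have o3 : 3 <= o by lia.
exists (ext_graph o m octahedron_sym octahedron_irr); split.
- exact: ext_saturated.
- exact: ext_min_degree.
- have := ext_edges m octahedron_sym octahedron_irr o3 ok apex.
  by rewrite r12 sz wt; lia.
Qed.

Lemma star_sizes : exists2 G : sgraph 'I_(6 + 3 * 0), saturated (Kbip 3 3) G & #|edges G| = 12.
Proof.
have ok : tab_check star_rel 6 by vm_compute.
have apex : all (fun w => star_rel 0 w == hub w) (iota 0 6) by [].
exists (@ext_graph star_rel 6 0 star_sym star_irr).
  exact: (@ext_saturated star_rel 6 0).
have := @ext_edges star_rel 6 0 star_sym star_irr isT ok apex.
have -> : rest_seq star_rel 6 = [::] by [].
have -> : rest_weight star_rel 6 = 0 by [].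
have -> : star_rel 1 2 by [].
by rewrite /=; lia.
Qed.

(** * The saturation numbers *)

Lemma saturated_edges_2n (V : finType) (G : sgraph V) :
  5 <= #|V| -> saturated (Kbip 3 3) G -> 2 * #|V| <= #|edges G|.
Proof.
move=> n5 satG; have min2 v : 2 <= degree G v by apply: saturated_min2 satG; lia.
case: (boolP [exists v, degree G v == 2]) => [/existsP[v /eqP]|/existsPn n2].
  move=> /degree2_nbrs[x [y [nxy nbv]]].
  by apply: (two_edges_small satG nbv nxy); lia.
have min3 v : 3 <= degree G v by rewrite ltn_neqAle eq_sym n2 min2.
case: (boolP [exists v, degree G v == 3]) => [/existsP[v /eqP dv]|/existsPn n3].
  exact: min3_edges dv.
rewrite -(leq_pmul2l (isT : 0 < 2)) mulnA -handshake -cardsT.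
apply: leq_trans (sum_ge_const (f := degree G) (c := 4) _) _ => [v _|].
  by have := n3 v; have := min3 v; lia.
by rewrite (eq_bigl xpredT) // => v; rewrite inE.
Qed.

Theorem theorem1p3 :
  (forall n : nat, 6 <= n <= 8 -> sat_is n (Kbip 3 3) (2 * n)) /\
  (forall n : nat, 9 <= n ->
     sat_deg_is 2 n (Kbip 3 3) (3 * n - 9) /\
     sat_deg_ge 5 n (Kbip 3 3) (3 * n - 9)).
Proof.
split=> n hn.
  split; last first.
    by move=> k [G [satG <-]]; rewrite -{1}[n]card_ord saturated_edges_2n // card_ord; lia.
  have [->|n7] : n = 6 \/ 7 <= n <= 11 by lia.
    by have [G satG eG] := star_sizes; exists G.
  have [G [satG _ eG]] := octahedron_sizes 0 n7.
  rewrite -{1}(addn0 n) -[0]/(3 * 0); exists G; split=> //; lia.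
split; [split|].
(* The table size from 9 to 11 matches [n] modulo 3, and triangles supply the rest. *)
- have o711 : 7 <= 9 + n %% 3 <= 11 by lia.
  have [G [satG minG eG]] := octahedron_sizes ((n - 9) %/ 3) o711.
  have e : 9 + n %% 3 + 3 * ((n - 9) %/ 3) = n by lia.
  by move: G satG minG eG; rewrite e => G satG minG eG; exists G; split=> //; lia.
- move=> k [G [satG [[v dv] _] <-]]; have [x [y [nxy nbv]]] := degree2_nbrs dv.
  by rewrite -[X in 3 * X]card_ord; apply: two_edges_large satG nbv nxy.
- move=> k [G [satG [[v dv] minG] <-]].
  rewrite -[X in 3 * X]card_ord; apply: min5_edges satG _ dv => u.
  by apply: minG; exists u.
Qed.
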